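(* A sequence $\tau=(\tau_n)_{n=0}^\infty\in\mathbb{C}^\infty$ is an analytic moment functional on $(l_{\mathrm{fin}},\star)$, i.e. there exists a measure $\mu\in\mathcal{M}_a(\mathbb{R})$ such that $$\tau_n=\int_{\mathbb{R}}(x)_n\,d\mu(x),\quad n\in\mathbb{N}_0,$$ if and only if $\tau$ is $\star$-positive, i.e. $\tau(f\star\bar f)=\sum_{n=0}^\infty\tau_n(f\star\bar f)_n\ge0$ for all $f\in l_{\mathrm{fin}}$, and $\tau\in l^2_-$. For an analytic moment functional $\tau$ on $(l_{\mathrm{fin}},\star)$ the measure $\mu\in\mathcal{M}_a(\mathbb{R})$ in this representation is unique.
   Context: $\mathbb{N}_0=\{0,1,2,\dots\}$. $\mathbb{C}^\infty$ is the space of all complex sequences, $l_{\mathrm{fin}}$ its subspace of finitely supported sequences; $\tau\in\mathbb{C}^\infty$ acts on $l_{\mathrm{fin}}$ by $\tau(f)=\sum_n\tau_nf_n$; $\bar f=(\bar f_n)_n$. The Newton polynomials are $(x)_0=1$, $(x)_n=x(x-1)\cdots(x-n+1)$ for $n\ge1$. The product $\star$ on $l_{\mathrm{fin}}$ is $f\star g:=I^{-1}(If\cdot Ig)$, where $I:l_{\mathrm{fin}}\to\mathbb{C}[x]$ is the linear bijection $(If)(x)=\sum_nf_n(x)_n$. $l^2_-$ is the set of $\xi\in\mathbb{C}^\infty$ for which there is $q\in\mathbb{N}$ with $\sum_{n=0}^\infty|\xi_n|^2(n!)^{-2}2^{-qn}<\infty$. $\mathcal{M}_a(\mathbb{R})$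 is the set of non-negative finite Borel measures $\mu$ on $\mathbb{R}$ whose Laplace transform $l_\mu(\lambda)=\int_{\mathbb{R}}e^{x\lambda}\,d\mu(x)$ is well-defined in a neighborhood of $0\in\mathbb{C}$ and holomorphic at $0$. *)

(* Defs.v *)
From HB Require Import structures.
From mathcomp Require Import all_boot all_order all_algebra.
From mathcomp Require Import all_classical all_reals all_analysis.
From mathcomp Require Import complex.
Set Implicit Arguments.
Unset Strict Implicit.
Unset Printing Implicit Defensive.
Import Order.TTheory GRing.Theory Num.Theory numFieldNormedType.Exports.
Local Open Scope classical_set_scope.
Local Open Scope ring_scope.
Local Open Scope complex_scope.

Definition newton (K : comNzRingType) (n : nat) : {poly K} :=
  \prod_(i < n) ('X - (i%:R)%:P).

(* A finitely supported sequence (f_n) is encoded by {poly R[i]}, via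
   f_n = f`_n.  Only the vector space structure of that type is meaningful
   for sequences: the product on lfin is [star] below, not polynomial
   multiplication. *)
Definition lfin (R : realType) := {poly R[i]}.

Definition lfin_conj (R : realType) (f : lfin R) : lfin R := map_poly conjc f.

Definition pairing (R : realType) (tau : nat -> R[i]) (f : lfin R) : R[i] :=
  \sum_(n < size f) tau n * f`_n.

Definition newton_iso (R : realType) (f : lfin R) : {poly R[i]} :=
  \sum_(n < size f) f`_n *: newton R[i] n.

(* The inverse map; see [newton_isoK] and [newton_isoVK]. *)
Definition newton_isoV (R : realType) (p : {poly R[i]}) : lfin R :=
  xget (0 : {poly R[i]}) [set f : lfin R | newton_iso f = p].

Definition star (R : realType) (f g : lfin R) : lfin R :=
  newton_isoV (newton_iso f * newton_iso g).

Definition star_positive (R : realType) (tau : nat -> R[i]) : Prop :=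
  forall f : lfin R, 0 <= pairing tau (star f (lfin_conj f)).

Definition l2_minus (R : realType) (xi : nat -> R[i]) : Prop :=
  exists q : nat,
    (\sum_(0 <= n <oo)
       ((Normc.normc (xi n)) ^+ 2 * (n`!%:R) ^- 2 * 2 ^- (q * n))%:E < +oo)%E.

Definition cexp (R : realType) (z : R[i]) : R[i] :=
  (expR (complex.Re z) * cos (complex.Im z))
    +i* (expR (complex.Re z) * sin (complex.Im z)).

Definition cintegrable (R : realType)
    (mu : {finite_measure set (measurableTypeR R) -> \bar R})
    (f : R -> R[i]) : Prop :=
  mu.-integrable setT (fun x => (complex.Re (f x))%:E) /\
  mu.-integrable setT (fun x => (complex.Im (f x))%:E).

Definition cintegral (R : realType)
    (mu : {finite_measure set (measurableTypeR R) -> \bar R})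
    (f : R -> R[i]) : R[i] :=
  (\int[mu]_x complex.Re (f x)) +i* (\int[mu]_x complex.Im (f x)).

Definition laplace (R : realType)
    (mu : {finite_measure set (measurableTypeR R) -> \bar R})
    (lambda : R[i]) : R[i] :=
  cintegral mu (fun x => cexp (x%:C * lambda)).

(* Over the scalar field R[i], derivability along 1 is complex
   differentiability; R[i]^o is R[i] as a normed space over itself. *)
Definition holomorphic_at (R : realType) (f : R[i] -> R[i]) (z0 : R[i]) : Prop :=
  \forall z \near (z0 : R[i]^o), derivable (f : R[i]^o -> R[i]^o) z 1.

Definition analytic_measure (R : realType)
    (mu : {finite_measure set (measurableTypeR R) -> \bar R}) : Prop :=
  (\forall lambda \near (0 : R[i]^o),
     cintegrable mu (fun x => cexp (x%:C * lambda))) /\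
  holomorphic_at (laplace mu) 0.

Definition represents (R : realType)
    (mu : {finite_measure set (measurableTypeR R) -> \bar R})
    (tau : nat -> R[i]) : Prop :=
  forall n, tau n = (\int[mu]_x (newton R n).[x])%:C.

Definition analytic_moment_functional (R : realType) (tau : nat -> R[i]) : Prop :=
  exists mu : {finite_measure set (measurableTypeR R) -> \bar R},
    analytic_measure mu /\ represents mu tau.

Section NewtonIso.
Variable R : realType.
Implicit Types f g : lfin R.

Lemma newton_isoE (N : nat) f : (size f <= N)%N ->
  newton_iso f = \sum_(n < N) f`_n *: newton R[i] n.
Proof.
move=> fN; rewrite /newton_iso.
rewrite (big_ord_widen N (fun n => f`_n *: newton R[i] n) fN) big_mkcond /=.
apply: eq_bigr => i _; case: ltnP => // h.
by rewrite nth_default ?scale0r.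
Qed.

Lemma newton_iso_linear (a : R[i]) (f g : {poly R[i]}) :
  newton_iso (a *: f + g : {poly R[i]}) = a *: newton_iso f + newton_iso g.
Proof.
pose N := maxn (size f) (size g).
have hf : (size f <= N)%N by rewrite leq_maxl.
have hg : (size g <= N)%N by rewrite leq_maxr.
have hfg : (size (a *: f + g)%R <= N)%N.
  rewrite (leq_trans (size_polyD _ _)) // geq_max hg andbT.
  exact: leq_trans (size_scale_leq _ _) hf.
rewrite (newton_isoE hf) (newton_isoE hg) (newton_isoE hfg).
rewrite scaler_sumr -big_split; apply: eq_bigr => i _ /=.
by rewrite coefD coefZ scalerDl scalerA.
Qed.

Lemma monic_newton n : newton R[i] n \is monic.
Proof. by apply: monic_prod => i _; exact: monicXsubC. Qed.

Lemma size_newton n : size (newton R[i] n) = n.+1.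
Proof. by rewrite size_prod_XsubC /index_enum -enumT size_enum_ord. Qed.

Lemma size_newton_iso f : size (newton_iso f) = size f.
Proof.
have [->|f0] := eqVneq (f : {poly R[i]}) 0.
  by rewrite /newton_iso size_poly0 big_ord0 size_poly0.
rewrite /newton_iso; move: f0; rewrite -size_poly_gt0.
case sf: (size f) => [//|n] _.
have fn : f`_n != 0 by rewrite -[n]/(n.+1.-1) -sf -lead_coefE lead_coef_eq0
  -size_poly_eq0 sf.
rewrite big_ord_recr /= addrC size_polyDl size_scale // size_newton // ltnS.
apply: (leq_trans (size_sum _ _ _)); apply/bigmax_leqP => i _.
by rewrite (leq_trans (size_scale_leq _ _))// size_newton.
Qed.

Lemma newton_iso_inj : injective (@newton_iso R).
Proof.
move=> f g fg; apply/eqP; rewrite -(subr_eq0 (f : {poly R[i]}) g).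
rewrite addrC -scaleN1r -size_poly_eq0 -size_newton_iso newton_iso_linear fg.
by rewrite scaleN1r addNr size_poly0.
Qed.

Lemma newton_iso_surj (p : {poly R[i]}) : exists f : lfin R, newton_iso f = p.
Proof.
have [n] := ubnP (size p); elim: n p => // n IHn p.
rewrite ltnS => pn; have [->|p0] := eqVneq p 0.
  by exists (0 : {poly R[i]}); rewrite /newton_iso size_poly0 big_ord0.
pose m := (size p).-1.
have iX : newton_iso ('X^m : {poly R[i]}) = newton R[i] m.
  rewrite /newton_iso size_polyXn big_ord_recr /= coefXn eqxx scale1r.
  rewrite big1 ?add0r // => i _.
  by rewrite coefXn (ltn_eqF (ltn_ord i)) scale0r.
have sp : size p = m.+1 by rewrite prednK // size_poly_gt0.
have [f fE] : exists f : lfin R,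
    newton_iso f = p - lead_coef p *: newton R[i] m.
  apply: IHn; apply: leq_trans pn; rewrite sp ltnS.
  apply/leq_sizeP => j; rewrite leq_eqVlt => /orP[/eqP <-|mj].
    have lm : (newton R[i] m)`_m = 1.
      by rewrite -(monicP (monic_newton m)) lead_coefE size_newton.
    by rewrite coefB coefZ lm mulr1 lead_coefE subrr.
  by rewrite coefB coefZ !nth_default ?size_newton ?sp// mulr0 subrr.
exists (lead_coef p *: 'X^m + f : {poly R[i]}).
by rewrite newton_iso_linear iX fE addrC subrK.
Qed.

Lemma newton_isoVK : cancel (@newton_isoV R) (@newton_iso R).
Proof.
move=> p; rewrite /newton_isoV.
by case: xgetP => [f _ //|no]; case: (newton_iso_surj p) => f /no.
Qed.

Lemma newton_isoK : cancel (@newton_iso R) (@newton_isoV R).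
Proof. by move=> f; apply: newton_iso_inj; rewrite newton_isoVK. Qed.

End NewtonIso.

(* Main.v *)
(* Necessity.  Positivity is [tau (f * conj f) = int |I f|^2].  For the growth,
   [|(x)_n| <= (|x| + n)^n <= n! (e^c / c)^n e^(c |x|)].

   Sufficiency.  Read [tau] as a functional [L] on real polynomials.  A strictly
   positive polynomial is [g * conj g] (its roots are conjugate pairs), so [L] is
   nonnegative on nonnegative polynomials.  M. Riesz' extension theorem extends
   [L] to a positive functional [Lam] on the polynomially bounded functions, and
   [a |-> Lam 1_(-oo, a]], made right continuous, is the distribution function of
   a measure with the moments of [L].  The growth of [tau] gives
   [|L (x^n)| <= C (2 M)^n n!], hence exponential moments and a holomorphic
   Laplace transform.

   Uniqueness.  The bounded functions [g] such that [p g] has the same integral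
   under both measures for every polynomial [p] form a vector space closed under
   bounded pointwise limits and, by exponential integrability, under
   multiplication by [sin (t x)] for small [t].  It thus contains the polynomials
   in [sin (t x)], then the indicator of [sin (t a) < sin (t x)], and letting [t]
   tend to 0 the indicator of the ray [a < x]. *)
Require Import Defs.
From HB Require Import structures.
From mathcomp Require Import all_boot all_order all_algebra.
From mathcomp Require Import all_classical all_reals all_analysis.
From mathcomp Require Import measurable_realfun complex.
From mathcomp Require Import ring lra.
Set Implicit Arguments.
Unset Strict Implicit.
Unset Printing Implicit Defensive.
Import Order.TTheory GRing.Theory Num.Theory numFieldNormedType.Exports.
Local Open Scope classical_set_scope.
Local Open Scope ring_scope.
Local Open Scope complex_scope.

(** * Integrals of real functions *)

(** The obstacle in the sufficiency part is that [Lam] is only finitely additive, so the measure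
    read off from its values on rays need not integrate a function to its value under [Lam]. Two
    devices recover the moments. A polynomial vanishing at [- T] and [T] and cut off outside has
    nearly equal Riemann-Stieltjes sums for [Lam] and for the measure, although the two distribution
    functions may differ at jumps. And multiplying [p] by the cut-off [1 - x^2 / T^2] changes it by
    at most a polynomial carrying a factor [1 / T]; [L] controls that polynomial, so no mass is lost
    at infinity. The growth condition bounds signed moments only. Exponential integrability is
    therefore drawn from the series of [2 cosh (e x)], whose terms are even powers and need no
    absolute moments. In the Laplace and uniqueness arguments the exponent [e] is a budget, divided
    between the exponential or sine factors and the polynomial ones. *)

Section real_integrals.
Context d (T : measurableType d) (R : realType).
Implicit Types (mu : {measure set T -> \bar R}) (f g : T -> R).

Lemma integrable_addr mu f g : mu.-integrable setT (EFin \o f) ->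
  mu.-integrable setT (EFin \o g) -> mu.-integrable setT (EFin \o (f + g)).
Proof. by move=> If Ig; exact: (integrableD measurableT If Ig). Qed.

Lemma integrable_scaler mu (a : R) f : mu.-integrable setT (EFin \o f) ->
  mu.-integrable setT (EFin \o (a *: f)).
Proof. by move=> If; exact: (integrableZl measurableT _ If). Qed.

Lemma Rintegral_addr mu f g : mu.-integrable setT (EFin \o f) ->
  mu.-integrable setT (EFin \o g) ->
  \int[mu]_x (f + g) x = \int[mu]_x f x + \int[mu]_x g x.
Proof. by move=> If Ig; exact: RintegralD. Qed.

Lemma Rintegral_scaler mu (a : R) f : mu.-integrable setT (EFin \o f) ->
  \int[mu]_x (a *: f) x = a * \int[mu]_x f x.
Proof. by move=> If; exact: RintegralZl. Qed.

Lemma integrable_le_norm mu f g : measurable_fun setT f ->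
  (forall x, `|f x| <= g x) -> mu.-integrable setT (EFin \o g) ->
  mu.-integrable setT (EFin \o f).
Proof.
move=> mf fg; apply: le_integrable => //; first exact/measurable_EFinP.
by move=> x _ /=; rewrite lee_fin (le_trans (fg x))// ler_norm.
Qed.

Lemma measurable_of_integrable mu f :
  mu.-integrable setT (EFin \o f) -> measurable_fun setT f.
Proof. by move=> /measurable_int/measurable_EFinP. Qed.

Lemma Rintegral_dominated_cvg mu (f_ : nat -> T -> R) f g :
  (forall n, measurable_fun setT (f_ n)) ->
  (forall x, f_ n x @[n --> \oo] --> f x) ->
  (forall n x, `|f_ n x| <= g x) -> mu.-integrable setT (EFin \o g) ->
  mu.-integrable setT (EFin \o f) /\
  \int[mu]_x f_ n x @[n --> \oo] --> \int[mu]_x f x.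
Proof.
move=> mf cf fg Ig.
have mlim : measurable_fun setT f.
  by apply: (measurable_fun_cvg mf) => x _; exact: cf.
have [|||||If _ cI] := @dominated_convergence _ _ _ mu setT measurableT
    (fun n => EFin \o f_ n) (EFin \o f) (EFin \o g).
- by move=> n; exact/measurable_EFinP.
- exact/measurable_EFinP.
- by apply: aeW => x _; apply: cvg_EFin; [exact: nearW|exact: cf].
- exact: Ig.
- by apply: aeW => x n _; rewrite /= lee_fin.
split => //; have fin : (\int[mu]_x (f x)%:E)%E \is a fin_num.
  exact: integrable_fin_num.
by apply: fine_cvg; rewrite fineK.
Qed.

(** Fatou's lemma bounds the integral of the limit by [l]. This serves where no dominating function
    is at hand: for squares of polynomials under the constructed measure, and for exponentials known
    through their series. *)
Lemma integrable_of_cvg_Rintegral mu (f_ : nat -> T -> R) f (l : R) :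
  (forall n, mu.-integrable setT (EFin \o f_ n)) ->
  (forall n x, 0 <= f_ n x) -> (forall x, f_ n x @[n --> \oo] --> f x) ->
  \int[mu]_x f_ n x @[n --> \oo] --> l ->
  mu.-integrable setT (EFin \o f).
Proof.
move=> If f0 cf cI.
have mf n : measurable_fun setT (f_ n) := measurable_of_integrable (If n).
have f_ge0 x : 0 <= f x.
  rewrite -(cvg_lim (@Rhausdorff R) (cf x)); apply: limr_ge.
    by apply/cvg_ex; exists (f x); exact: cf.
  exact: nearW.
apply/integrableP; split.
  by apply/measurable_EFinP; apply: (measurable_fun_cvg mf) => x _; exact: cf.
have := @fatou _ _ _ mu setT measurableT (fun n => EFin \o f_ n) _ _.
have einf x : limn_einf (fun n => (f_ n x)%:E) = (f x)%:E.
  have cfE : (f_ n x)%:E @[n --> \oo] --> (f x)%:E.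
    by apply: cvg_EFin; [exact: nearW|exact: cf].
  by rewrite is_cvg_limn_einfE ?(cvg_lim _ cfE)//; apply/cvg_ex; exists (f x)%:E.
have cIE : (\int[mu]_x (f_ n x)%:E)%E @[n --> \oo] --> l%:E.
  rewrite (_ : (fun n => _) = EFin \o (fun n => \int[mu]_x f_ n x)).
    by apply: cvg_EFin; [exact: nearW|exact: cI].
  apply/funext => n /=; rewrite /Rintegral fineK//; exact: (integrable_fin_num measurableT (If n)).
rewrite [X in (_ <= X)%E](is_cvg_limn_einfE _); last by apply/cvg_ex; exists l%:E.
rewrite [X in (_ <= X)%E](cvg_lim _ cIE)//.
under eq_integral do rewrite einf.
move=> h; under eq_integral do rewrite /= ger0_norm//.
apply: le_lt_trans (ltry l); apply: h => [n|n x _].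
  exact/measurable_EFinP.
by rewrite /= lee_fin.
Qed.

End real_integrals.

(** * Extension of positive functionals on polynomials *)

(** [inf] takes a default value on a set that is not bounded below, so each use exhibits a lower
    bound [c]. *)
Lemma inf_le_lbound (R : realType) (A : set R) (c a : R) :
  (forall a, A a -> c <= a) -> A a -> inf A <= a.
Proof. by move=> cA Aa; apply: ge_inf => //; exists c. Qed.

(* Hahn-Banach without partial functionals: a sublinear functional that is
   minimal for the pointwise order is linear, and Zorn's lemma puts a minimal
   one below any given one.  Functionals are normalized to vanish off [D] so
   that the order is antisymmetric. *)
Definition sublinear_on (R : realType) (V : lmodType R) (D : set V)
    (q : V -> R) :=
  [/\ forall u, ~ D u -> q u = 0,
      forall u v, D u -> D v -> q (u + v) <= q u + q v &
      forall t u, 0 <= t -> D u -> q (t *: u) <= t * q u].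

Section hahn_banach.
Variables (R : realType) (V : lmodType R) (D : set V).
Hypothesis D0 : D 0.
Hypothesis DD : forall u v, D u -> D v -> D (u + v).
Hypothesis DZ : forall (a : R) u, D u -> D (a *: u).

Let DN u : D u -> D (- u).
Proof. by rewrite -scaleN1r; exact: DZ. Qed.

Lemma sublinear_on0 q : sublinear_on D q -> q 0 = 0.
Proof.
move=> [_ qD qZ]; apply/eqP; rewrite eq_le; apply/andP; split.
  by have := qZ 0 0 (lexx _) D0; rewrite scale0r mul0r.
by have := qD 0 0 D0 D0; rewrite addr0; lra.
Qed.

Lemma sublinear_onN q u : sublinear_on D q -> D u -> - q (- u) <= q u.
Proof.
move=> sq Du; have [_ qD _] := sq.
by have := qD u (- u) Du (DN Du); rewrite subrr (sublinear_on0 sq); lra.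
Qed.

(** Homogeneity with factor [t^-1] at [t *: u]. The one-sided condition of [sublinear_on], which is
    the one that infima inherit easily, thus amounts to equality. *)
Lemma sublinear_onZ q t u : sublinear_on D q -> 0 <= t -> D u ->
  t * q u <= q (t *: u).
Proof.
move=> sq; rewrite le_eqVlt => /predU1P[<-|t0] Du.
  by rewrite mul0r scale0r (sublinear_on0 sq).
have [_ _ /(_ t^-1 (t *: u))] := sq.
rewrite invr_ge0 ltW// => /(_ isT (DZ _ Du)).
by rewrite scalerA mulVf ?gt_eqF// scale1r mulrC ler_pdivlMr// mulrC.
Qed.

(** The pointwise infimum works; it is finite because [s u >= - s (- u) >= - p (- u)]. Comparability
    gives subadditivity: of two members, one nearly optimal at [u] and one at [v], the smaller
    serves at both points. *)
Lemma sublinear_on_chain_lb (p : V -> R)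
    (A : set {q | sublinear_on D q /\ forall u, D u -> q u <= p u}) :
  (forall s t, A s -> A t -> (forall u, sval t u <= sval s u) \/
                             (forall u, sval s u <= sval t u)) ->
  A !=set0 ->
  exists t : {q | sublinear_on D q /\ forall u, D u -> q u <= p u},
    forall s, A s -> forall u, sval t u <= sval s u.
Proof.
move=> tA [s0 As0]; pose B u := [set sval s u | s in A].
have B0 u : B u !=set0 by exists (sval s0 u), s0.
have Blb u a : D u -> B u a -> - p (- u) <= a.
  move=> Du [s As <-]; have [sq qp] := svalP s.
  apply: le_trans (sublinear_onN sq Du); rewrite lerN2.
  by apply: qp; exact: DN.
pose q u := inf (B u).
have le_q c u : (forall s, A s -> c <= sval s u) -> c <= q u.
  by move=> cs; apply: lb_le_inf => // _ [s As <-]; exact: cs.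
have qle u s : D u -> A s -> q u <= sval s u.
  by move=> Du As; apply: (@inf_le_lbound _ _ (- p (- u))) => [a|]; [exact: Blb|exists s].
have q0 u : ~ D u -> q u = 0.
  move=> nDu; rewrite /q (_ : B u = [set 0]) ?inf1//.
  apply/seteqP; split => [_ [s As <-]|_ ->].
    by have [[s_0 _ _] _] := svalP s; exact: s_0.
  by exists s0 => //; have [[s_0 _ _] _] := svalP s0; exact: s_0.
have sq : sublinear_on D q /\ forall u, D u -> q u <= p u.
  split; last first.
    by move=> u Du; apply: le_trans (qle _ _ Du As0) _; have [_] := svalP s0; exact.
  split => // [u v Du Dv|t u t0 Du].
  - rewrite -lerBlDr; apply: (le_q) => s1 As1.
    rewrite lerBlDr [leRHS]addrC -lerBlDr; apply: (le_q) => s2 As2.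
    rewrite lerBlDr.
    have [s12|s21] := tA _ _ As1 As2.
      apply: le_trans (qle _ _ (DD Du Dv) As2) _.
      have [[_ s2D _] _] := svalP s2.
      by apply: le_trans (s2D _ _ Du Dv) _; rewrite addrC lerD2l.
    apply: le_trans (qle _ _ (DD Du Dv) As1) _.
    have [[_ s1D _] _] := svalP s1.
    by apply: le_trans (s1D _ _ Du Dv) _; rewrite addrC lerD2r.
  - move: t0; rewrite le_eqVlt => /predU1P[<-|t0].
      rewrite scale0r mul0r; apply: le_trans (qle _ _ D0 As0) _.
      by have [/sublinear_on0 -> _] := svalP s0.
    rewrite mulrC -ler_pdivrMr//; apply: (le_q) => s As.
    rewrite ler_pdivrMr//; apply: le_trans (qle _ _ (DZ _ Du) As) _.
    have [[_ _ sZ] _] := svalP s.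
    by rewrite mulrC; apply: sZ => //; exact: ltW.
exists (exist _ q sq) => s As u /=.
have [Du|nDu] := pselect (D u); first exact: qle.
by rewrite (q0 _ nDu); have [[-> // _ _] _] := svalP s.
Qed.

(** For fixed [y], the infimum over [t >= 0] of [m (u + t y) - t m y] is again sublinear in [u] and
    below [m], hence equal to [m] by minimality. The choice [t = 1] at [x] reads
    [m x <= m (x + y) - m y]. *)
Lemma minimal_sublinear_on_additive m : sublinear_on D m ->
  (forall q, sublinear_on D q -> (forall u, q u <= m u) -> q = m) ->
  forall u v, D u -> D v -> m (u + v) = m u + m v.
Proof.
move=> sm mmin x y Dx Dy; have [m0 mD mZ] := sm.
apply/eqP; rewrite eq_le mD//=.
pose B u := [set m (u + t *: y) - t * m y | t in [set t | 0 <= t]].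
have B0 u : B u !=set0 by exists (m (u + 0 *: y) - 0 * m y); exists 0 => /=.
have Blb u a : D u -> B u a -> - m (- u) <= a.
  move=> Du [t /= t0 <-]; have := mD (u + t *: y) (- u) (DD Du (DZ _ Dy)) (DN Du).
  rewrite addrAC subrr add0r; have := sublinear_onZ sm t0 Dy; lra.
pose q u := if pselect (D u) then inf (B u) else 0.
have qE u : D u -> q u = inf (B u) by rewrite /q; case: pselect.
have le_q c u : D u -> (forall t, 0 <= t -> c <= m (u + t *: y) - t * m y) ->
    c <= q u.
  by move=> Du ct; rewrite qE//; apply: lb_le_inf => // _ [t t0 <-]; exact: ct.
have qle u t : D u -> 0 <= t -> q u <= m (u + t *: y) - t * m y.
  move=> Du t0; rewrite qE//; apply: (@inf_le_lbound _ _ (- m (- u))).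
    by move=> a; exact: Blb.
  by exists t.
have qm u : q u <= m u.
  have [Du|nDu] := pselect (D u).
    by have := qle _ _ Du (lexx 0); rewrite scale0r mul0r subr0 addr0.
  by rewrite (m0 _ nDu) /q; case: pselect.
have sq : sublinear_on D q.
  split => [u|u v Du Dv|s u s0 Du].
  - by rewrite /q; case: pselect.
  - rewrite -lerBlDr; apply: (le_q) => // t1 t1_0.
    rewrite lerBlDr [leRHS]addrC -lerBlDr; apply: (le_q) => // t2 t2_0.
    rewrite lerBlDr; apply: le_trans (qle _ _ (DD Du Dv) (addr_ge0 t1_0 t2_0)) _.
    have := mD (u + t1 *: y) (v + t2 *: y) (DD Du (DZ _ Dy)) (DD Dv (DZ _ Dy)).
    by rewrite addrACA -scalerDl; lra.
  - move: s0; rewrite le_eqVlt => /predU1P[<-|s0].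
      by rewrite scale0r mul0r -(sublinear_on0 sm).
    rewrite mulrC -ler_pdivrMr//; apply: (le_q) => // t t0.
    rewrite ler_pdivrMr//; apply: le_trans (qle _ _ (DZ _ Du) (mulr_ge0 (ltW s0) t0)) _.
    rewrite -scalerA -scalerDr; have := mZ _ _ (ltW s0) (DD Du (DZ t Dy)).
    by rewrite mulrBl; lra.
have := qle _ _ Dx ler01; rewrite (mmin _ sq qm) scale1r mul1r; lra.
Qed.

Lemma hahn_banach_on (p : V -> R) :
  (forall u v, D u -> D v -> p (u + v) <= p u + p v) ->
  (forall t u, 0 <= t -> D u -> p (t *: u) <= t * p u) ->
  exists m : V -> R, [/\ forall u v, D u -> D v -> m (u + v) = m u + m v,
    forall t u, D u -> m (t *: u) = t * m u & forall u, D u -> m u <= p u].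
Proof.
move=> pD pZ.
pose T := {q | sublinear_on D q /\ forall u, D u -> q u <= p u}.
(* The pointwise order is reversed, so that the maximal element given by Zorn's lemma is a minimal
   functional. *)
pose Rel (s t : T) := `[< forall u, sval t u <= sval s u >].
pose p0 u := if pselect (D u) then p u else 0.
have p0E u : D u -> p0 u = p u by rewrite /p0; case: pselect.
have sp0 : sublinear_on D p0 /\ forall u, D u -> p0 u <= p u.
  split => [|u Du]; last by rewrite p0E.
  split => [u|u v Du Dv|t u t0 Du]; first by rewrite /p0; case: pselect.
    by rewrite !p0E ?pD//; exact: DD.
  by rewrite !p0E ?pZ//; exact: DZ.
have [||||[m [sm mp]] mmax] := @Zorn T Rel.
- by move=> t; apply/asboolP => u.
- move=> r s t /asboolP rs /asboolP st; apply/asboolP => u.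
  exact: le_trans (st u) (rs u).
- move=> [s ps] [t pt] /asboolP /= st /asboolP /= ts; apply: eq_exist.
  by apply/funext => u; apply/eqP; rewrite eq_le st ts.
- move=> A tA; have [A0|nA] := pselect (A !=set0).
    have [|t tle] := @sublinear_on_chain_lb p A _ A0.
      by move=> s t /tA/[apply] -[/asboolP|/asboolP]; [left|right].
    by exists t => s As; apply/asboolP; exact: tle.
  by exists (exist _ p0 sp0) => s As; exfalso; apply: nA; exists s.
have mmin q : sublinear_on D q -> (forall u, q u <= m u) -> q = m.
  move=> sq qm; have qp u : D u -> q u <= p u.
    by move=> Du; apply: le_trans (qm u) (mp u Du).
  have /(_ _)/(congr1 sval) := mmax (exist _ q (conj sq qp)).
  by apply; apply/asboolP.
have madd := minimal_sublinear_on_additive sm mmin.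
have mN u : D u -> m (- u) = - m u.
  by move=> Du; apply/eqP; rewrite -addr_eq0 addrC -madd ?subrr ?sublinear_on0//; exact: DN.
have [_ _ mZ] := sm.
have mZge t u : 0 <= t -> D u -> m (t *: u) = t * m u.
  by move=> t0 Du; apply/eqP; rewrite eq_le mZ//= sublinear_onZ.
exists m; split => // t u Du; have [t0|/ltW t0] := leP 0 t; first exact: mZge.
rewrite -[t]opprK scaleNr mN; last exact: DZ.
by rewrite mZge ?mulNr// oppr_ge0.
Qed.

End hahn_banach.

(** These functions lie between two polynomials, which keeps the infimum over polynomial majorants
    finite. Indicators of rays are among them. *)
Definition poly_bounded (R : realType) (f : R -> R) :=
  exists q : {poly R}, forall x, `|f x| <= q.[x].

Section poly_bounded.
Variable R : realType.
Implicit Types (f g : R -> R) (p q : {poly R}).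

Lemma le_poly_bounded f g :
  (forall x, `|f x| <= `|g x|) -> poly_bounded g -> poly_bounded f.
Proof. by move=> fg [q gq]; exists q => x; apply: le_trans (fg x) (gq x). Qed.

Lemma poly_bounded_horner p : poly_bounded (horner p).
Proof.
exists (p ^+ 2 + 1) => x; rewrite !hornerE.
have := sqr_ge0 (`|p.[x]| - 1); have := normr_ge0 p.[x].
by rewrite -(real_normK (num_real p.[x])); nra.
Qed.

Lemma poly_bounded_cst (c : R) : poly_bounded (fun=> c).
Proof. by exists `|c|%:P => x; rewrite hornerC. Qed.

Lemma poly_boundedD f g : poly_bounded f -> poly_bounded g ->
  poly_bounded (f + g).
Proof.
move=> [p fp] [q gq]; exists (p + q) => x; rewrite hornerD.
by apply: le_trans (ler_normD _ _) _; exact: lerD.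
Qed.

Lemma poly_boundedZ (a : R) f : poly_bounded f -> poly_bounded (a *: f).
Proof.
move=> [p fp]; exists (`|a| *: p) => x; rewrite hornerZ.
by rewrite [X in `|X|](_ : _ = a * f x)// normrM ler_wpM2l.
Qed.

End poly_bounded.

(* M. Riesz: the functional [f |-> inf {L q | f <= q}] is sublinear. *)
Lemma positive_extension (R : realType) (L : {poly R} -> R) :
  (forall a p q, L (a *: p + q) = a * L p + L q) ->
  (forall p, (forall x, 0 <= p.[x]) -> 0 <= L p) ->
  exists Lam : (R -> R) -> R,
  [/\ forall f g, poly_bounded f -> poly_bounded g -> Lam (f + g) = Lam f + Lam g,
      forall a f, poly_bounded f -> Lam (a *: f) = a * Lam f,
      forall f g, poly_bounded f -> poly_bounded g ->
        (forall x, f x <= g x) -> Lam f <= Lam g &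
      forall p, Lam (horner p) = L p].
Proof.
move=> Llin Lpos.
have LD p q : L (p + q) = L p + L q by rewrite -[p]scale1r Llin mul1r scale1r.
have L0 : L 0 = 0 by have := LD 0 0; rewrite addr0; lra.
have LZ a p : L (a *: p) = a * L p by have := Llin a p 0; rewrite L0 !addr0.
have Lle p q : (forall x, p.[x] <= q.[x]) -> L p <= L q.
  move=> pq; rewrite -subr_ge0 -mulN1r -LZ -LD; apply: Lpos => x.
  by rewrite hornerD hornerZ mulN1r subr_ge0.
pose B (f : R -> R) := [set L q | q in [set q : {poly R} | forall x, f x <= q.[x]]].
pose P (f : R -> R) := inf (B f).
have B0 f : poly_bounded f -> B f !=set0.
  by move=> [q fq]; exists (L q), q => // x; apply: le_trans (ler_norm _) (fq x).
have le_P c f : poly_bounded f -> (forall q, (forall x, f x <= q.[x]) -> c <= L q) -> c <= P f.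
  by move=> Df cq; apply: lb_le_inf; [exact: B0|move=> _ [q fq <-]; exact: cq].
(* With [|f| <= r], every majorant [s] of [f] satisfies [- r <= s], so [L (- r)] bounds the infimum
   from below. *)
have Ple f q : poly_bounded f -> (forall x, f x <= q.[x]) -> P f <= L q.
  move=> [r fr] fq; apply: (@inf_le_lbound _ _ (L (- r))); last by exists q.
  move=> _ [s /= fs <-]; apply: Lle => x; rewrite hornerN.
  by apply: le_trans (fs x); rewrite lerNl; apply: le_trans (fr x); rewrite ler_normr lexx orbT.
have [||||| Lam [LamD LamZ LamP]] := @hahn_banach_on R (R -> R) (@poly_bounded R) _ _ _ P _ _.
- exact: (poly_bounded_cst 0).
- exact: poly_boundedD.
- exact: poly_boundedZ.
- move=> f g Df Dg.
  rewrite -lerBlDr; apply: (le_P) => // q1 h1.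
  rewrite lerBlDr [leRHS]addrC -lerBlDr; apply: (le_P) => // q2 h2.
  rewrite lerBlDr -LD; apply: Ple => [|x]; first exact: poly_boundedD.
  by rewrite hornerD [leLHS]addrC lerD.
- move=> t f; rewrite le_eqVlt => /predU1P[<- Df|t0 Df].
    rewrite scale0r mul0r -L0; apply: Ple => [|x]; first exact: poly_bounded_cst.
    by rewrite horner0.
  rewrite mulrC -ler_pdivrMr//; apply: (le_P) => // q fq; rewrite ler_pdivrMr// mulrC -LZ.
  apply: Ple => [|x]; first exact: poly_boundedZ.
  by rewrite hornerZ [leLHS](_ : _ = t * f x)// ler_wpM2l// ltW.
(* Positivity of the extension: the polynomial 0 is a majorant of [f]. *)
have Lamle f : poly_bounded f -> (forall x, f x <= 0) -> Lam f <= 0.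
  by move=> Df f0; apply: le_trans (LamP _ Df) _; rewrite -L0; apply: Ple => // x; rewrite horner0.
have LamN f : poly_bounded f -> Lam (- f) = - Lam f.
  by move=> Df; rewrite -scaleN1r LamZ// mulN1r.
have Lamp p : Lam (horner p) <= L p.
  apply: le_trans (LamP _ (poly_bounded_horner p)) _.
  by apply: Ple => //; exact: poly_bounded_horner.
exists Lam; split => //.
- move=> f g Df Dg fg; rewrite -subr_le0 -LamN// -LamD//; last first.
    by rewrite -scaleN1r; exact: poly_boundedZ.
  apply: Lamle => [|x].
    by apply: poly_boundedD => //; rewrite -scaleN1r; exact: poly_boundedZ.
  by rewrite [leLHS](_ : _ = f x - g x)// subr_le0.
(* The inequality [Lam p <= L p], applied also to [- p], gives equality. *)
- move=> p; apply/eqP; rewrite eq_le Lamp/= -lerN2 -LamN; last exact: poly_bounded_horner.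
  have -> : - L p = L (-1 *: p) by rewrite LZ mulN1r.
  rewrite (_ : - horner p = horner (-1 *: p)) ?Lamp//.
  by apply/funext => x; rewrite hornerZ mulN1r.
Qed.

(** * The measure of a bounded monotone function *)

Section measure_of_monotone.
Variables (R : realType) (F : R -> R) (M : R).
Hypothesis ndF : {homo F : x y / x <= y}.
Hypothesis F_ge0 : forall x, 0 <= F x.
Hypothesis F_leM : forall x, F x <= M.

(** For monotone [F] this is the right limit [F(a+)]. *)
Definition rc_env (a : R) : R := inf [set F b | b in [set b | a < b]].

Lemma rc_env_le a b : a < b -> rc_env a <= F b.
Proof. by move=> ab; apply: ge_inf; [exists 0 => _ [c _ <-]|exists b]. Qed.

Lemma le_rc_env_of a c : (forall b, a < b -> c <= F b) -> c <= rc_env a.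
Proof.
move=> h; apply: lb_le_inf => [|_ [b ab <-]]; last exact: h.
by exists (F (a + 1)), (a + 1) => //=; rewrite ltrDl.
Qed.

Lemma le_rc_env a : F a <= rc_env a.
Proof. by apply: le_rc_env_of => b /ltW; exact: ndF. Qed.

Lemma rc_env_homo : {homo rc_env : x y / x <= y}.
Proof.
move=> x y xy; apply: le_rc_env_of => b yb.
exact/rc_env_le/(le_lt_trans xy).
Qed.

Lemma rc_env_right_continuous :
  right_continuous (rc_env : R -> R).
Proof.
move=> a; apply/cvgrPdist_le => e e0.
have [b ab Fb] : exists2 b, a < b & F b <= rc_env a + e.
  apply: contrapT => h; suff: rc_env a + e <= rc_env a by lra.
  apply: le_rc_env_of => b ab; rewrite leNgt; apply/negP => Fb.
  by apply: h; exists b => //; exact: ltW.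
near=> x.
have ax : a <= x by near: x; exact: nbhs_right_ge.
have xb : x < b by near: x; exact: nbhs_right_lt.
have := rc_env_homo ax; have := rc_env_le xb.
by move=> h1 h2; rewrite ler0_norm; lra.
Unshelve. all: by end_near. Qed.

Definition rc_env_cumulative : cumulative R R :=
  HB.pack rc_env
    (isCumulative.Build R _ R rc_env rc_env_homo rc_env_right_continuous).

Let mu0 := lebesgue_stieltjes_measure rc_env_cumulative.

Let mu0E a b : a <= b ->
  mu0 `]a, b]%classic = (rc_env b - rc_env a)%:E.
Proof.
move=> ab; rewrite /mu0 /lebesgue_stieltjes_measure /measure_extension measurable_mu_extE/=.
  by rewrite wlength_itv_bnd.
exact: is_ocitv.
Qed.

Let mu0_fin : fin_num_fun mu0.
Proof.
apply: lty_fin_num_fun.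
have mE n : measurable (`](- n%:R), n%:R]%classic : set (measurableTypeR R)).
  exact: sub_sigma_algebra (is_ocitv _ _).
have ndE : {homo (fun n : nat => `](- n%:R), n%:R]%classic : set (measurableTypeR R)) :
    m n / (m <= n)%N >-> (m <= n)%O}.
  move=> m n mn; apply/subsetPset => x /=; rewrite !in_itv/= => /andP[nx xn].
  rewrite (le_trans xn) ?ler_nat// andbT (le_lt_trans _ nx)//.
  by rewrite lerN2 ler_nat.
have UE : \bigcup_n (`](- n%:R), n%:R]%classic : set (measurableTypeR R)) = setT.
  rewrite -subTset => x _; exists (Num.bound `|x|) => //=.
  have := archi_boundP (normr_ge0 x); rewrite in_itv/=.
  have := ler_norm x; have := ler_norm (- x); rewrite normrN => h1 h2 h3.
  by apply/andP; split; [lra|exact: le_trans h2 (ltW h3)].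
have := nondecreasing_cvg_mu (mu := mu0) mE (bigcup_measurable (fun k _ => mE k)) ndE.
rewrite UE => mucvg; rewrite -(cvg_lim _ mucvg)//.
(* The mass of []-n, n]] is at most [rc_env n <= F (n + 1) <= M]. *)
apply: (@le_lt_trans _ _ M%:E); last exact: ltry.
apply: lime_le; first by apply/cvg_ex; eexists; exact: mucvg.
apply: nearW => n /=.
have nn : - n%:R <= n%:R :> R by rewrite (@le_trans _ _ 0)// oppr_le0.
rewrite [X in (X <= _)%E](mu0E nn) lee_fin lerBlDr (@le_trans _ _ M)//; last first.
  by rewrite lerDl (le_trans (F_ge0 _) (le_rc_env _)).
by apply: le_trans (rc_env_le _) (F_leM _); exact: ltr_pwDr.
Qed.

Definition measure_of_monotone :
    {finite_measure set (measurableTypeR R) -> \bar R} :=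
  HB.pack (lebesgue_stieltjes_measure rc_env_cumulative)
    (Measure_isFinite.Build _ _ _
      (lebesgue_stieltjes_measure rc_env_cumulative) mu0_fin).

Lemma measure_of_monotoneE a b : a <= b ->
  measure_of_monotone `]a, b]%classic = (rc_env b - rc_env a)%:E.
Proof. exact: mu0E. Qed.

End measure_of_monotone.

(** * The moment problem *)

Lemma le_of_le_divn (R : realType) (x y c : R) :
  (forall n : nat, x <= y + c / n.+1%:R) -> x <= y.
Proof.
move=> h; rewrite leNgt; apply/negP; rewrite -subr_gt0 => xy.
have [c0|c0] := leP c 0.
  have := h 0%N; rewrite divr1; lra.
pose n := Num.bound (c / (x - y)).
have := archi_boundP (ltW (divr_gt0 c0 xy)); rewrite -/n => hn.
suff : c / n.+1%:R < x - y by have := h n; move: (c / _) => z; lra.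
rewrite ltr_pdivrMr// mulrC -ltr_pdivrMr//; apply: lt_trans hn _.
by rewrite ltr_nat.
Qed.

Lemma horner_lipschitz (R : realType) (T : R) (q : {poly R}) : exists2 C : R,
  0 <= C & forall x y, `|x| <= T -> `|y| <= T -> `|q.[x] - q.[y]| <= C * `|x - y|.
Proof.
elim/poly_ind: q => [|q c [C C0 qC]].
  by exists 0 => // x y _ _; rewrite !horner0 subrr normr0 mul0r.
(* In [(q x - q y) x + q y (x - y)] the first increment costs [C T], and [|q 0| + C T] bounds [q y].
   The absolute value covers [T < 0], when the claim is vacuous. *)
exists (C * `|T| + `|q.[0]| + C * `|T|); first by rewrite !addr_ge0// mulr_ge0.
move=> x y xT yT; rewrite !hornerE.
have T0 : 0 <= T by exact: le_trans xT.
rewrite (ger0_norm T0).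
have -> : q.[x] * x + c - (q.[y] * y + c) =
    (q.[x] - q.[y]) * x + q.[y] * (x - y) by ring.
apply: le_trans (ler_normD _ _) _; rewrite !normrM.
have h1 : `|q.[x] - q.[y]| * `|x| <= C * `|x - y| * T.
  by apply: ler_pM => //; exact: qC.
have h2 : `|q.[y]| <= `|q.[0]| + C * T.
  have := qC y 0 yT; rewrite normr0 subr0 => /(_ T0) h.
  have := ler_normD (q.[y] - q.[0]) q.[0]; rewrite subrK => h'.
  by have := ler_wpM2l C0 yT; lra.
by have := ler_wpM2r (normr_ge0 (x - y)) h2; lra.
Qed.

Lemma sum_abel (R : comNzRingType) (u v : nat -> R) n :
  \sum_(j < n) u j.+1 * (v j.+1 - v j) =
  u n * v n - u 0%N * v 0%N - \sum_(j < n) (u j.+1 - u j) * v j.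
Proof.
elim: n => [|n IH]; first by rewrite !big_ord0; ring.
by rewrite !big_ord_recr /= IH; ring.
Qed.

Lemma indic_itv_infty (R : realType) (a x : R) :
  \1_(`]-oo, a]) x = (x <= a)%R%:R :> R.
Proof. by rewrite indicE mem_setE in_itv. Qed.

(** * Riemann-Stieltjes sums of a positive functional *)

Section riemann_sums.
Variables (R : realType) (K : (R -> R) -> Prop) (E : (R -> R) -> R).
Hypothesis KD : forall f g, K f -> K g -> K (f + g).
Hypothesis KZ : forall (a : R) f, K f -> K (a *: f).
Hypothesis K1 : K (cst 1).
Hypothesis Kindic : forall a, K \1_(`]-oo, a]).
Hypothesis ED : forall f g, K f -> K g -> E (f + g) = E f + E g.
Hypothesis EZ : forall (a : R) f, K f -> E (a *: f) = a * E f.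
Hypothesis Ele : forall f g, K f -> K g -> (forall x, f x <= g x) -> E f <= E g.

Lemma functional_sum (h : nat -> R -> R) n : (forall j, K (h j)) ->
  K (\sum_(j < n) h j) /\ E (\sum_(j < n) h j) = \sum_(j < n) E (h j).
Proof.
move=> Kh; elim: n => [|n [IHK IHE]].
  rewrite !big_ord0 (_ : 0 = 0 *: cst 1 :> (R -> R)); last by rewrite scale0r.
  by split; [exact: KZ|rewrite EZ// mul0r].
by rewrite !big_ord_recr/=; split; [exact: KD|rewrite ED// IHE].
Qed.

(** [E] is abstract because the estimate is applied twice, to [Lam] on polynomially bounded
    functions and to the integral on integrable ones. It rests on positivity and finite additivity
    alone: on each cell [q] is within [C * delta] of its value at the right end point, and the cells
    cover at most once. *)
Lemma riemann_sum_close (q : {poly R}) (T C : R) (N : nat) :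
  let a j := - T + j%:R * (2 * T / N.+1%:R) in
  let phi x := q.[x] * (\1_(`]-oo, T]) x - \1_(`]-oo, - T]) x) in
  0 < T -> 0 <= C ->
  (forall x y, `|x| <= T -> `|y| <= T -> `|q.[x] - q.[y]| <= C * `|x - y|) ->
  K phi ->
  `|E phi - \sum_(j < N.+1) q.[a j.+1] *
      (E \1_(`]-oo, a j.+1]) - E \1_(`]-oo, a j]))| <=
  C * (2 * T / N.+1%:R) * E (cst 1).
Proof.
move=> a phi T0 C0 qC Kphi; pose delta := 2 * T / N.+1%:R.
have d0 : 0 < delta by rewrite /delta divr_gt0// mulr_gt0.
have aS j : a j.+1 = a j + delta by rewrite /a -/delta -natr1; ring.
have aN : a N.+1 = T by rewrite /a mulrCA divff ?pnatr_eq0//; ring.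
have a0 : a 0%N = - T by rewrite /a mul0r addr0.
have a_le j : (j <= N.+1)%N -> `|a j| <= T.
  move=> jN; rewrite ler_norml; apply/andP; split.
    by rewrite /a lerDl mulr_ge0// ltW.
  by rewrite -aN /a lerD2l; apply: ler_wpM2r; [exact: ltW|rewrite ler_nat].
(* The indicator of the cell []a j, a j.+1]], written with rays, on which [K] and [E] are given. *)
pose e j : R -> R := \1_(`]-oo, a j.+1]) + -1 *: \1_(`]-oo, a j]).
have eE j x : e j x = (x <= a j.+1)%R%:R - (x <= a j)%R%:R.
  by rewrite /e -!indic_itv_infty -[in RHS]mulN1r.
have Ke j : K (e j) by apply: KD => //; exact: KZ.
have EeE j : E (e j) = E \1_(`]-oo, a j.+1]) - E \1_(`]-oo, a j]).
  by rewrite ED ?EZ ?mulN1r//; exact: KZ.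
pose s := \sum_(j < N.+1) q.[a j.+1] *: e j.
have [|Ks Es] := functional_sum (h := fun j => q.[a j.+1] *: e j) N.+1.
  by move=> j; exact: KZ.
rewrite -/s in Ks Es.
have -> : \sum_(j < N.+1) q.[a j.+1] * (E \1_(`]-oo, a j.+1]) - E \1_(`]-oo, a j])) = E s.
  by rewrite Es; apply: eq_bigr => j _; rewrite EZ// EeE.
have phiE x : phi x = \sum_(j < N.+1) q.[x] * e j x.
  rewrite /phi -mulr_sumr; congr (_ * _).
  rewrite !indic_itv_infty -a0 -aN.
  under eq_bigr do rewrite eE.
  by rewrite -(big_mkord xpredT (fun j => (x <= a j.+1)%R%:R - (x <= a j)%R%:R)) telescope_sumr.
have e0 j x : 0 <= e j x.
  rewrite eE subr_ge0 ler_nat; case: (leP x (a j)) => // h.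
  by rewrite (le_trans h)// aS lerDl ltW.
have sE x : s x = \sum_(j < N.+1) q.[a j.+1] * e j x.
  by rewrite /s fct_sumE.
have sum_e x : \sum_(j < N.+1) e j x <= 1.
  under eq_bigr do rewrite eE.
  rewrite -(big_mkord xpredT (fun j => (x <= a j.+1)%R%:R - (x <= a j)%R%:R)) telescope_sumr//.
  by case: (x <= _); case: (x <= _) => /=; lra.
have close x : `|phi x - s x| <= C * delta.
  rewrite phiE sE -sumrB; apply: le_trans (ler_norm_sum _ _ _) _.
  apply: (@le_trans _ _ (\sum_(j < N.+1) C * delta * e j x)).
    apply: ler_sum => j _; rewrite -mulrBl normrM (ger0_norm (e0 _ _)).
    have [xj|xj] := boolP ((x <= a j.+1) && (a j < x)); last first.
      rewrite (_ : e j x = 0) ?mulr0//; rewrite eE.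
      case: (leP x (a j)) xj => [h|h]; rewrite ?andbT ?andbF.
        by rewrite (le_trans h) ?subrr// aS lerDl ltW.
      by move/negbTE => ->; rewrite subrr.
    apply: ler_wpM2r => //; case/andP: xj => xj1 xj2.
    have ha1 := a_le j.+1 (ltn_ord j); have ha2 := a_le j (ltnW (ltn_ord j)).
    have hx : `|x| <= T.
      move: ha1 ha2; rewrite !ler_norml => /andP[h1 h2] /andP[h3 h4].
      by apply/andP; split; lra.
    apply: le_trans (qC _ _ hx ha1) _; apply: ler_wpM2l => //.
    by move: xj1 xj2; rewrite aS => xj1 xj2; rewrite ler0_norm; lra.
  by rewrite -mulr_sumr ler_piMr// mulr_ge0// ltW.
have Kc : K ((C * delta) *: cst 1) by exact: KZ.
have E_le f g : K f -> K g -> (forall x, f x - g x <= C * delta) ->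
    E f - E g <= C * delta * E (cst 1).
  move=> Kf Kg fg; rewrite lerBlDr -EZ// -ED//; apply: Ele => //; first exact: KD.
  by move=> x; rewrite [leRHS](_ : _ = C * delta * 1 + g x)// mulr1 -lerBlDr.
rewrite -/delta ler_norml -opprB lerN2 opprB !E_le// => x.
  by have := close x; rewrite ler_norml => /andP[_].
by have := close x; rewrite ler_norml => /andP[]; rewrite -opprB lerN2.
Qed.

End riemann_sums.

(** * The measure of a positive functional and its integrals of cut-off polynomials *)

Section moment_measure.
Variables (R : realType) (Lam : (R -> R) -> R).
Hypothesis LamD : forall f g, poly_bounded f -> poly_bounded g ->
  Lam (f + g) = Lam f + Lam g.
Hypothesis LamZ : forall (a : R) f, poly_bounded f -> Lam (a *: f) = a * Lam f.
Hypothesis Lamle : forall f g, poly_bounded f -> poly_bounded g ->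
  (forall x, f x <= g x) -> Lam f <= Lam g.

Let F a := Lam \1_(`]-oo, a]).

Lemma poly_bounded_indic (A : set R) : poly_bounded \1_A.
Proof.
apply: le_poly_bounded (poly_bounded_cst 1) => x.
by rewrite normr1 indicE; case: (_ \in _); rewrite ?normr1 ?normr0.
Qed.

Let ndF : {homo F : x y / x <= y}.
Proof.
move=> x y xy; apply: Lamle => [||z]; [exact: poly_bounded_indic..|].
rewrite !indic_itv_infty ler_nat; case: (leP z x) => // zx.
by rewrite (le_trans zx xy).
Qed.

Let F_ge0 x : 0 <= F x.
Proof.
have -> : 0 = Lam (0 *: cst 1) by rewrite LamZ ?mul0r//; exact: poly_bounded_cst.
apply: Lamle => [||z]; last by rewrite scale0r.
  by apply: poly_boundedZ; exact: poly_bounded_cst.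
exact: poly_bounded_indic.
Qed.

Let F_le x : F x <= Lam (cst 1).
Proof.
apply: Lamle => [||z]; [exact: poly_bounded_indic|exact: poly_bounded_cst|].
by rewrite indicE; case: (_ \in _).
Qed.

Definition moment_measure := measure_of_monotone ndF F_ge0 F_le.
Local Notation mu := moment_measure.
Let G := rc_env F.

Let mu_indicB a b : a <= b ->
  \int[mu]_x \1_(`]-oo, b]) x - \int[mu]_x \1_(`]-oo, a]) x = G b - G a.
Proof.
move=> ab.
have mI (c : R) : measurable (`]-oo, c]%classic : set (measurableTypeR R)) by [].
rewrite /Rintegral !integral_indic// !setIT.
have -> : `]-oo, b]%classic = (`]-oo, a] `|` `]a, b])%classic :> set R.
  by rewrite -itv_bndbnd_setU.
rewrite measureU//; last first.
  apply/seteqP; split => // x /= []; rewrite !in_itv/= => xa /andP[ax _].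
  by move: (lt_le_trans ax xa); rewrite ltxx.
rewrite fineD ?fin_num_measure// addrAC subrr add0r.
by rewrite [X in fine X](measure_of_monotoneE ndF F_ge0 F_le ab).
Qed.

(* Abel summation moves the increments of [G - F] onto the polynomial, whose
   values at the two end points vanish; the interlacing
   [F a <= G a <= F b] for [a < b] bounds the sum of [G - F] over the mesh. *)
Lemma Lam_cutoff (q : {poly R}) (T : R) : 0 < T -> q.[T] = 0 -> q.[- T] = 0 ->
  let phi x := q.[x] * (\1_(`]-oo, T]) x - \1_(`]-oo, - T]) x) in
  poly_bounded phi /\ mu.-integrable setT (EFin \o phi) /\
  \int[mu]_x phi x = Lam phi.
Proof.
move=> T0 qT qNT phi; have [C C0 qC] := horner_lipschitz T q.
have phi_le x : `|phi x| <= `|q.[x]|.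
  rewrite normrM ler_piMr// !indic_itv_infty.
  by case: (leP x T); case: (leP x (- T)); rewrite ?subrr ?subr0 ?sub0r ?normrN ?normr0 ?normr1.
have Pphi : poly_bounded phi.
  exact: le_poly_bounded phi_le (poly_bounded_horner q).
have mphi : measurable_fun setT phi.
  apply: measurable_funM; first exact: measurable_poly.
  by apply: measurable_funB; apply: measurable_indic.
have Iphi : mu.-integrable setT (EFin \o phi).
  (* Since [q] vanishes at [T], it is bounded by [C |x - T| <= 2 C T] on the support of [phi]. *)
  apply: (@integrable_le_norm _ _ _ _ _ (cst (C * `|T| + C * `|T|))) => //; last first.
    exact: finite_measure_integrable_cst.
  move=> x; have [xT|xT] := leP `|x| T.
    apply: le_trans (phi_le x) _.
    have := qC x T xT; rewrite qT subr0 (ger0_norm (ltW T0)) => /(_ (lexx _)).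
    move=> /le_trans; apply; rewrite /cst -mulrDr; apply: ler_wpM2l => //.
    by apply: le_trans (ler_normB _ _) _; rewrite (ger0_norm (ltW T0)) lerD2r.
  rewrite (_ : phi x = 0) ?normr0 ?addr_ge0 ?mulr_ge0//.
  rewrite /phi !indic_itv_infty; move: xT; rewrite lter_normr => /orP[xT|xT].
    by rewrite !leNgt xT (lt_trans _ xT) ?subrr ?mulr0//; lra.
  by have -> : x <= - T; [lra|have -> : x <= T; [lra|rewrite subrr mulr0]].
split => //; split => //.
(* Three errors of order [C * delta]: the Riemann sum of [Lam] and the exchange of [F] for [G], each
   weighted by [Lam 1], and the Riemann sum of [mu], weighted by its total mass. *)
pose c := C * (2 * T) * (2 * Lam (cst 1) + \int[mu]_x cst 1 x).
apply/eqP; rewrite -subr_eq0 -normr_le0; apply: (@le_of_le_divn _ _ _ c) => N.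
rewrite add0r; pose delta := 2 * T / N.+1%:R.
have d0 : 0 < delta by rewrite divr_gt0// mulr_gt0.
pose a j := - T + j%:R * delta.
have a_lt j : a j < a j.+1 by rewrite /a -natr1 mulrDl mul1r; lra.
have aN : a N.+1 = T by rewrite /a mulrCA divff ?pnatr_eq0//; ring.
have a0 : a 0%N = - T by rewrite /a mul0r addr0.
have h1 := @riemann_sum_close _ (@poly_bounded R) Lam (@poly_boundedD R)
  (@poly_boundedZ R) (poly_bounded_cst 1) (fun _ => poly_bounded_indic _)
  LamD LamZ Lamle q T C N T0 C0 qC Pphi.
have h2 := @riemann_sum_close _ (fun f => mu.-integrable setT (EFin \o f))
  (fun f => \int[mu]_x f x) (@integrable_addr _ _ _ mu) (@integrable_scaler _ _ _ mu)
  _ _ (@Rintegral_addr _ _ _ mu) (@Rintegral_scaler _ _ _ mu) _ q T C N T0 C0 qC Iphi.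
rewrite -/delta in h1 h2.
have {}h2 := h2 (finite_measure_integrable_cst mu 1 measurableT)
  (fun b => integrable_indic mu (measurable_itv _))
  (fun f g If Ig fg => le_Rintegral measurableT If Ig (fun x _ => fg x)).
have Dge j : 0 <= G (a j) - F (a j) by rewrite subr_ge0; exact: le_rc_env.
have Dle j : G (a j) - F (a j) <= F (a j.+1) - F (a j).
  by rewrite lerD2r; exact: rc_env_le.
have h3 : `|\sum_(j < N.+1) q.[a j.+1] * (G (a j.+1) - G (a j)) -
    \sum_(j < N.+1) q.[a j.+1] * (F (a j.+1) - F (a j))| <= C * delta * Lam (cst 1).
  rewrite -sumrB (eq_bigr (fun j : 'I_N.+1 =>
    (fun j => q.[a j]) j.+1 * ((fun j => G (a j) - F (a j)) j.+1 -
       (fun j => G (a j) - F (a j)) j))); last by move=> j _ /=; ring.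
  rewrite (sum_abel (fun j => q.[a j]) (fun j => G (a j) - F (a j))).
  rewrite aN a0 qT qNT !mul0r subrr sub0r normrN.
  apply: le_trans (ler_norm_sum _ _ _) _.
  apply: (@le_trans _ _ (\sum_(j < N.+1) C * delta * (F (a j.+1) - F (a j)))).
    apply: ler_sum => j _; rewrite normrM (ger0_norm (Dge _)).
    apply: ler_pM => //.
    have a_le i : (i <= N.+1)%N -> `|a i| <= T.
      move=> iN; rewrite ler_norml; apply/andP; split.
        by rewrite /a lerDl mulr_ge0// ltW.
      by rewrite -aN /a lerD2l; apply: ler_wpM2r; [exact: ltW|rewrite ler_nat].
    apply: le_trans (qC _ _ (a_le _ (ltn_ord j)) (a_le _ (ltnW (ltn_ord j)))) _.
    apply: ler_wpM2l => //; rewrite /a -natr1 mulrDl mul1r ger0_norm; lra.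
  rewrite -mulr_sumr; apply: ler_wpM2l; first by rewrite mulr_ge0// ltW.
  rewrite -(big_mkord xpredT (fun j => F (a j.+1) - F (a j))) telescope_sumr//.
  by have := F_ge0 (a 0%N); have := F_le (a N.+1); lra.
have {}h2 : `|\int[mu]_x phi x - \sum_(j < N.+1) q.[a j.+1] * (G (a j.+1) - G (a j))| <=
    C * delta * \int[mu]_x cst 1 x.
  apply: le_trans h2; rewrite le_eqVlt; apply/orP; left; apply/eqP.
  congr (`|_ - _|); apply: eq_bigr => j _; congr (_ * _).
  by rewrite -(mu_indicB (ltW (a_lt j))).
have cE : c / N.+1%:R = C * delta * Lam (cst 1) + C * delta * Lam (cst 1) +
    C * delta * \int[mu]_x cst 1 x by rewrite /c /delta; ring.
rewrite cE; move: h1 h2 h3; rewrite -/(F _).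
set S1 := \sum_(j < _) _ * (G _ - G _); set I := \int[mu]_x phi x.
set S2 := \sum_(j < _) q.[a j.+1] * (F _ - F _).
rewrite !ler_norml.
move=> /andP[h1a h1b] /andP[h2a h2b] /andP[h3a h3b].
by apply/andP; split; lra.
Qed.

End moment_measure.

Lemma cvg_of_le_divn (R : realType) (u : nat -> R) (l c : R) :
  (forall n, `|u n - l| <= c / n.+1%:R) -> u n @[n --> \oo] --> l.
Proof.
move=> h; apply/cvgrPdist_le => e e0; near=> n.
rewrite distrC; apply: le_trans (h n) _.
rewrite ler_pdivrMr// -ler_pdivrMl// mulrC.
apply: (@le_trans _ _ n%:R); last by rewrite ler_nat.
by near: n; exact: nbhs_infty_ger.
Unshelve. all: by end_near. Qed.

(** [Lam] and [mu] agree on the cut-offs [p * chi n], and [L] bounds the error made on [p] by a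
    multiple of [1 / n.+1]. So the integrals of [p * chi n] tend to [L p]. Fatou then makes squares
    integrable, hence all polynomials, and dominated convergence with bound [|p|] identifies the
    limit. *)
Lemma hamburger (R : realType) (L : {poly R} -> R) :
  (forall a p q, L (a *: p + q) = a * L p + L q) ->
  (forall p, (forall x, 0 <= p.[x]) -> 0 <= L p) ->
  exists mu : {finite_measure set (measurableTypeR R) -> \bar R},
  forall p, mu.-integrable setT (EFin \o horner p) /\ \int[mu]_x p.[x] = L p.
Proof.
move=> Llin Lpos.
have [Lam [LamD LamZ Lamle LamL]] := positive_extension Llin Lpos.
pose mu := moment_measure LamZ Lamle; exists mu.
pose T n : R := n.+1%:R.
have T0 n : 0 < T n by [].
have T2 n : 0 < T n ^+ 2 by rewrite exprn_gt0.
(* The parabola vanishes at both ends of the window, as [Lam_cutoff] requires, and tends to 1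
   pointwise. *)
pose chi n x : R := (1 - (T n ^+ 2)^-1 * x ^+ 2) *
  (\1_(`]-oo, T n]) x - \1_(`]-oo, - T n]) x).
have chiE n x : chi n x =
    if (- T n < x) && (x <= T n) then 1 - (T n ^+ 2)^-1 * x ^+ 2 else 0.
  rewrite /chi !indic_itv_infty; case: (leP x (- T n)) => [h|_] /=.
    by have -> : x <= T n by [have := T0 n; lra]; rewrite subrr mulr0.
  by case: (leP x (T n)) => _ /=; rewrite mulr0n subr0 ?mulr1n ?mulr0n ?mulr1 ?mulr0.
have sq_ge0 n x : 0 <= (T n ^+ 2)^-1 * x ^+ 2.
  by rewrite mulr_ge0 ?sqr_ge0// invr_ge0 ltW.
have sqE n x : (T n ^+ 2)^-1 * x ^+ 2 = 1 - (T n ^+ 2)^-1 * ((T n - x) * (T n + x)).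
  by rewrite -subr_sqr mulrBr mulVf ?gt_eqF//; ring.
have chi_bnd n x : 0 <= chi n x <= 1.
  rewrite chiE; case: ifP => [/andP[h1 h2]|_]; last by lra.
  have h := sq_ge0 n x; rewrite gerBl h andbT sqE subKr.
  by rewrite mulr_ge0 ?invr_ge0 ?(ltW (T2 n))// mulr_ge0; lra.
have chi_close n x : 1 - chi n x <= (T n ^+ 2)^-1 * x ^+ 2.
  rewrite chiE; case: ifP => [_|/negbT h]; first by rewrite subKr.
  rewrite subr0 sqE -subr_ge0 (_ : _ - _ = (T n ^+ 2)^-1 * ((x - T n) * (T n + x))); last by ring.
  rewrite mulr_ge0 ?invr_ge0 ?(ltW (T2 n))//; have := T0 n => Tn.
  move: h; rewrite negb_and -!leNgt -ltNge => /orP[h|h].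
    by rewrite mulr_le0//; lra.
  by rewrite mulr_ge0//; lra.
have chi_close1 n x : 1 - chi n x <= x ^+ 2 / n.+1%:R.
  apply: le_trans (chi_close n x) _; rewrite mulrC; apply: ler_wpM2l; first exact: sqr_ge0.
  by rewrite lef_pV2 ?posrE// /T expr2 ler_peMl ?ler1n.
have main p n : mu.-integrable setT (EFin \o (fun x => p.[x] * chi n x)) /\
    `|\int[mu]_x (p.[x] * chi n x) - L p| <= L ((p ^+ 2 + 1%:P) * 'X^2) / n.+1%:R.
  pose q := p * (1%:P - (T n ^+ 2)^-1 *: 'X^2).
  have qE x : q.[x] = p.[x] * (1 - (T n ^+ 2)^-1 * x ^+ 2).
    by rewrite hornerM hornerD hornerN hornerZ hornerXn hornerC.
  have [||] := Lam_cutoff LamD LamZ Lamle (q := q) (T0 n).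
  - by rewrite qE mulVf ?subrr ?mulr0// gt_eqF.
  - by rewrite qE sqrrN mulVf ?subrr ?mulr0// gt_eqF.
  have -> : (fun x => q.[x] * (\1_(`]-oo, T n]) x - \1_(`]-oo, - T n]) x)) =
      (fun x => p.[x] * chi n x).
    by apply: funext => x; rewrite qE /chi -mulrA.
  rewrite -/mu => Pphi [Iphi intE]; split; first exact: Iphi.
  have -> : \int[mu]_x (p.[x] * chi n x) = Lam (fun x => p.[x] * chi n x) := intE.
  (* A polynomial majorant of [|p| (1 - chi n)]: [p^2 + 1] dominates [|p|], and [x^2 / n.+1]
     dominates [1 - chi n]. *)
  pose r : {poly R} := (n.+1%:R)^-1 *: ((p ^+ 2 + 1%:P) * 'X^2).
  have L0 : L 0 = 0 by have := Llin 1 0 0; rewrite scaler0 addr0; lra.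
  have -> : L ((p ^+ 2 + 1%:P) * 'X^2) / n.+1%:R = L r.
    by have := Llin (n.+1%:R)^-1 ((p ^+ 2 + 1%:P) * 'X^2) 0; rewrite L0 !addr0 [RHS]mulrC => ->.
  have key x : `|p.[x] * chi n x - p.[x]| <= r.[x].
    have /andP[c0 c1] := chi_bnd n x.
    rewrite -[X in _ - X]mulr1 -mulrBr normrM [`|chi n x - 1|]ler0_norm ?opprB; last by lra.
    have -> : r.[x] = (p.[x] ^+ 2 + 1) * (x ^+ 2 / n.+1%:R).
      by rewrite /r hornerZ hornerM hornerD horner_exp hornerXn hornerC; ring.
    apply: ler_pM => //; first by lra.
      have := sqr_ge0 (`|p.[x]| - 1); have := normr_ge0 p.[x].
      by rewrite -(real_normK (num_real p.[x])); nra.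
  have Pr := poly_bounded_horner r.
  have Lam_le f g : poly_bounded f -> poly_bounded g ->
      (forall x, f x - g x <= r.[x]) -> Lam f - Lam g <= Lam (horner r).
    move=> Pf Pg fg; rewrite lerBlDr -LamD//; apply: (Lamle) => // [|x].
      exact: poly_boundedD.
    by rewrite [leRHS](_ : _ = r.[x] + g x)// -lerBlDr.
  have Pp := poly_bounded_horner p.
  rewrite -(LamL r) -(LamL p) ler_norml -opprB lerN2 opprB !Lam_le// => x.
    by have := key x; rewrite ler_norml => /andP[_].
  by have := key x; rewrite ler_norml => /andP[]; rewrite -opprB lerN2.
have cvgL p : \int[mu]_x (p.[x] * chi n x) @[n --> \oo] --> L p.
  by apply: cvg_of_le_divn => n; exact: (main p n).2.
have chi_cvg p x : p.[x] * chi n x @[n --> \oo] --> p.[x].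
  apply: (@cvg_of_le_divn _ _ _ (`|p.[x]| * x ^+ 2)) => n.
  have /andP[c0 c1] := chi_bnd n x.
  rewrite -[X in _ - X]mulr1 -mulrBr normrM [`|chi n x - 1|]ler0_norm ?opprB ?subr_le0//.
  by rewrite -mulrA; apply: ler_wpM2l.
have mphi (p : {poly R}) n :
    measurable_fun (setT : set (measurableTypeR R)) (fun x => p.[x] * chi n x).
  exact: measurable_of_integrable (main p n).1.
have Isq p : mu.-integrable setT (EFin \o horner (p ^+ 2)).
  apply: (@integrable_of_cvg_Rintegral _ _ _ mu
    (fun n x => (p ^+ 2).[x] * chi n x) _ (L (p ^+ 2))) => [n|n x|x|].
  - exact: (main _ _).1.
  - by rewrite mulr_ge0 ?horner_exp ?sqr_ge0//; case/andP: (chi_bnd n x).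
  - exact: chi_cvg.
  - exact: cvgL.
have Ip p : mu.-integrable setT (EFin \o horner p).
  apply: (@integrable_le_norm _ (measurableTypeR R) R mu _
    (horner (p ^+ 2) + cst 1)); first exact: measurable_poly.
    move=> x; rewrite [leRHS](_ : _ = (p ^+ 2).[x] + 1)// !hornerE.
    have := sqr_ge0 (`|p.[x]| - 1); have := normr_ge0 p.[x].
    by rewrite -(real_normK (num_real p.[x])); nra.
  apply: integrable_addr; first exact: Isq.
  exact: finite_measure_integrable_cst.
move=> p; split; first exact: Ip.
have [||||_ cI] := @Rintegral_dominated_cvg _ _ _ mu (fun n x => p.[x] * chi n x)
    (horner p) (fun x => `|p.[x]|).
- exact: mphi.
- exact: chi_cvg.
- move=> n x; have /andP[c0 c1] := chi_bnd n x.
  by rewrite normrM ler_piMr// ger0_norm.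
- exact: integrable_norm (Ip p).
exact: cvg_unique cI (cvgL p).
Qed.

(** * Sums of squares and star-positive functionals *)

Local Notation toC := (real_complex _).

Section complex_lemmas.
Variable R : realType.
Implicit Types (z w : R[i]).

Lemma ReD z w : complex.Re (z + w) = complex.Re z + complex.Re w.
Proof. by case: z => a b; case: w. Qed.

Lemma ImD z w : complex.Im (z + w) = complex.Im z + complex.Im w.
Proof. by case: z => a b; case: w. Qed.

Lemma Re_realM (a : R) z : complex.Re (a%:C * z) = a * complex.Re z.
Proof. by case: z => b c /=; rewrite mul0r subr0. Qed.

Lemma Im_realM (a : R) z : complex.Im (a%:C * z) = a * complex.Im z.
Proof. by case: z => b c /=; rewrite mul0r addr0. Qed.

Lemma realC_eq z : complex.Im z = 0 -> z = (complex.Re z)%:C.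
Proof. by case: z => a b /= ->. Qed.

End complex_lemmas.

Section sums_of_squares.
Variable R : realType.
Implicit Types p q : {poly R}.

(** Divide by the real quadratic with roots [z] and its conjugate. The remainder [c + d X] vanishes
    at [z]; its imaginary part [d Im z] forces [d = 0], and then [c = 0]. *)
Lemma complex_root_quadratic p (z : R[i]) :
  complex.Im z != 0 -> root (map_poly toC p) z ->
  exists q, p = q * (('X - (complex.Re z)%:P) ^+ 2 + (complex.Im z ^+ 2)%:P).
Proof.
set a := complex.Re z; set b := complex.Im z => b0 pz.
pose m : {poly R} := ('X - a%:P) ^+ 2 + (b ^+ 2)%:P.
have mz : (map_poly toC m).[z] = 0.
  rewrite rmorphD/= rmorphXn/= rmorphB/= map_polyX !map_polyC/= !hornerE.
  rewrite /a /b; clear; case: z => u v /=.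
  by apply/eqP; rewrite eq_complex/=; apply/andP; split; apply/eqP => /=; ring.
have sm : size m = 3%N.
  rewrite /m size_polyDl ?size_exp_XsubC// size_polyC.
  by case: (_ == _).
have m0 : m != 0 by rewrite -size_poly_gt0 sm.
exists (p %/ m); rewrite -/m [LHS](divp_eq p m).
suff -> : p %% m = 0 by rewrite addr0.
set r := p %% m.
have sr : (size r <= 2)%N by rewrite -ltnS -sm ltn_modp.
have rz : (map_poly toC r).[z] = 0.
  have : (map_poly toC p).[z] = 0 by exact/eqP.
  by rewrite {1}(divp_eq p m) rmorphD rmorphM/= hornerD hornerM mz mulr0 add0r.
have rE : r = (r`_0)%:P + r`_1 *: 'X.
  apply/polyP => i; rewrite coefD coefC coefZ coefX.
  case: i => [|[|i]]; rewrite /= ?mulr0 ?addr0 ?mulr1 ?add0r//.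
  by rewrite nth_default// (leq_trans sr).
move: rz; rewrite {1}rE -mul_polyC rmorphD rmorphM/= !map_polyC map_polyX/= !hornerE.
move: (r`_0) (r`_1) rE => c d rE.
rewrite [z]complexE -/a -/b => /eqP; rewrite eq_complex /= => /andP[/eqP h1 /eqP h2].
have d0 : d = 0.
  apply/eqP; move: h2 => /eqP.
  by rewrite !(mul0r,mul1r,mulr0,add0r,addr0,subr0) mulf_eq0 (negbTE b0) orbF.
by move: h1; rewrite rE d0 !(mul0r,mul1r,mulr0,add0r,addr0,subr0,scale0r) => ->.
Qed.

(* Strict positivity rules out real roots, so the roots come in conjugate
   pairs and no parity of multiplicities is needed. *)
Lemma pos_poly_sos p : (forall x, 0 < p.[x]) ->
  exists g : {poly R[i]}, map_poly toC p = g * map_poly conjc g.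
Proof.
have [n] := ubnP (size p); elim: n p => // n IH p; rewrite ltnS => pn p_gt0.
have [p1|p1] := leqP (size p) 1.
  have pE := size1_polyC p1; have c0 : 0 < p`_0 by have := p_gt0 0; rewrite pE hornerC coefC.
  exists ((Num.sqrt p`_0)%:C)%:P; rewrite [in LHS]pE !map_polyC/= oppr0.
  rewrite -polyCM; congr (_ %:P); apply/eqP; rewrite eq_complex/=.
  by rewrite !(mul0r,mulr0,subr0,addr0) -expr2 sqr_sqrtr ?(ltW c0)// !eqxx.
have /closed_rootP[z pz] : size (map_poly toC p) != 1%N.
  by rewrite size_map_poly gtn_eqF.
have b0 : complex.Im z != 0.
  apply/eqP => z0; move: pz; rewrite (realC_eq z0) /root horner_map/=.
  by rewrite fmorph_eq0 gt_eqF.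
have [q pE] := complex_root_quadratic b0 pz.
set a := complex.Re z in pE; set b := complex.Im z in pE b0.
set m := _ + _ in pE.
have mx x : 0 < m.[x].
  rewrite /m hornerD hornerC horner_exp hornerXsubC.
  by rewrite ltr_wpDl ?sqr_ge0// lt_def sqr_ge0 sqrf_eq0 b0.
have [g gE] : exists g : {poly R[i]}, map_poly toC q = g * map_poly conjc g.
  apply: IH => [|x]; last by have := p_gt0 x; rewrite pE hornerM pmulr_lgt0.
  have sm : size m = 3%N.
    by rewrite /m size_polyDl ?size_exp_XsubC// size_polyC; case: (_ == _).
  have q0 : q != 0 by apply/eqP => q0; have := p_gt0 0; rewrite pE q0 mul0r horner0 ltxx.
  have m0 : m != 0 by rewrite -size_poly_gt0 sm.
  apply: leq_trans pn; rewrite pE size_mul// sm addn3/=.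
  by rewrite ltnS leqnSn.
(* One root of the conjugate pair goes to each factor. *)
exists (('X - z%:P) * g).
rewrite rmorphM rmorphB/= map_polyX map_polyC/= mulrACA -gE mulrC pE rmorphM/=; congr (_ * _).
rewrite /m rmorphD/= rmorphXn/= rmorphB/= map_polyX !map_polyC/=.
rewrite /a /b; clear.
have -> : ('X - z%:P) * ('X - (z^*)%C%:P) =
    'X^2 - (z + z^*%C)%:P * 'X + (z * z^*%C)%:P :> {poly R[i]}.
  by rewrite polyCD polyCM; ring.
have -> : (('X - ((complex.Re z)%:C)%:P) ^+ 2 + ((complex.Im z ^+ 2)%:C)%:P)%R
   = 'X^2 - ((complex.Re z)%:C + (complex.Re z)%:C)%:P * 'X +
     ((complex.Re z)%:C ^+ 2 + (complex.Im z ^+ 2)%:C)%:P :> {poly R[i]}.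
  by rewrite !polyCD polyC_exp; ring.
case: z => u v; congr (_ - _ %:P * _ + _ %:P); apply/eqP; rewrite eq_complex /=.
  by apply/andP; split; apply/eqP; ring.
by apply/andP; split; apply/eqP; ring.
Qed.

End sums_of_squares.

Section newton.
Variable K : comNzRingType.

Lemma newton0 : newton K 0 = 1.
Proof. by rewrite /newton big_ord0. Qed.

Lemma newtonS n : newton K n.+1 = newton K n * ('X - (n%:R)%:P).
Proof. by rewrite /newton big_ord_recr. Qed.

Lemma mulX_newton n : 'X * newton K n = newton K n.+1 + n%:R *: newton K n.
Proof. by rewrite newtonS -mul_polyC; ring. Qed.

End newton.

Lemma map_newton (K1 K2 : comNzRingType) (f : {rmorphism K1 -> K2}) n :
  map_poly f (newton K1 n) = newton K2 n.
Proof.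
rewrite rmorph_prod/=; apply: eq_bigr => i _.
by rewrite rmorphB/= map_polyX map_polyC/= rmorph_nat.
Qed.

(** * The functional on polynomials attached to a sequence *)

Section pairing.
Variables (R : realType) (tau : nat -> R[i]).

Lemma pairingE (N : nat) (f : lfin R) : (size f <= N)%N ->
  pairing tau f = \sum_(n < N) tau n * f`_n.
Proof.
move=> fN; rewrite /pairing (big_ord_widen N (fun n => tau n * f`_n) fN).
rewrite big_mkcond; apply: eq_bigr => i _; case: ltnP => // h.
by rewrite nth_default ?mulr0.
Qed.

Lemma pairing_linear (a : R[i]) (f g : {poly R[i]}) :
  pairing tau (a *: f + g : {poly R[i]}) = a * pairing tau f + pairing tau g.
Proof.
pose N := maxn (size f) (size g).
have hf : (size f <= N)%N by rewrite leq_maxl.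
have hg : (size g <= N)%N by rewrite leq_maxr.
have hfg : (size (a *: f + g)%R <= N)%N.
  rewrite (leq_trans (size_polyD _ _)) // geq_max hg andbT.
  exact: leq_trans (size_scale_leq _ _) hf.
rewrite (pairingE hf) (pairingE hg) (pairingE hfg) mulr_sumr -big_split.
by apply: eq_bigr => i _ /=; rewrite coefD coefZ; ring.
Qed.

(** [tau] transported along [I]: it sends [(x)_n] to [tau n], and [star] becomes the ordinary
    product. *)
Definition poly_functional (p : {poly R[i]}) : R[i] :=
  pairing tau (newton_isoV p).

Lemma poly_functional_linear (a : R[i]) (p q : {poly R[i]}) :
  poly_functional (a *: p + q) = a * poly_functional p + poly_functional q.
Proof.
rewrite /poly_functional -pairing_linear; congr (pairing tau _).
by apply: newton_iso_inj; rewrite newton_iso_linear !newton_isoVK.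
Qed.

Lemma newton_iso_polyXn n : newton_iso ('X^n : {poly R[i]}) = newton R[i] n.
Proof.
rewrite /newton_iso size_polyXn big_ord_recr /= coefXn eqxx scale1r.
rewrite big1 ?add0r // => i _.
by rewrite coefXn (ltn_eqF (ltn_ord i)) scale0r.
Qed.

Lemma poly_functional_newton n : poly_functional (newton R[i] n) = tau n.
Proof.
rewrite /poly_functional -newton_iso_polyXn newton_isoK.
rewrite (@pairingE n.+1) ?size_polyXn// big_ord_recr/= coefXn eqxx mulr1.
by rewrite big1 ?add0r// => i _; rewrite coefXn (ltn_eqF (ltn_ord i)) mulr0.
Qed.

Lemma newton_iso_conj (f : lfin R) :
  newton_iso (lfin_conj f) = map_poly conjc (newton_iso f).
Proof.
have sf : size (lfin_conj f) = size f by rewrite size_map_poly.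
rewrite /newton_iso sf rmorph_sum/=; apply: eq_bigr => i _.
by rewrite coef_map -!mul_polyC rmorphM/= map_polyC map_newton.
Qed.

Lemma newton_iso_star (f : lfin R) : newton_iso (star f (lfin_conj f)) =
  newton_iso f * map_poly conjc (newton_iso f).
Proof. by rewrite /star newton_isoVK newton_iso_conj. Qed.

(** In [R[i]], [0 <= z] also says that [z] is real. Sums of squares therefore give real values on
    strictly positive polynomials, and differences of these give real values everywhere. A
    nonnegative [p] is reached through the strictly positive [p + 1 / n.+1]. *)
Lemma star_positive_functional : star_positive tau ->
  exists L : {poly R} -> R,
  [/\ forall a p q, L (a *: p + q) = a * L p + L q,
      forall p, (forall x, 0 <= p.[x]) -> 0 <= L p &
      forall n, tau n = (L (newton R n))%:C].
Proof.
move=> tau_ge0; pose Lc p := poly_functional (map_poly toC p).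
have Lclin a p q : Lc (a *: p + q) = a%:C * Lc p + Lc q.
  by rewrite /Lc rmorphD/= map_polyZ/= poly_functional_linear.
have Lc_pos p : (forall x, 0 < p.[x]) -> 0 <= Lc p.
  move=> /pos_poly_sos[g pE]; have [f fE] := newton_iso_surj g.
  rewrite /Lc /poly_functional pE -fE -newton_iso_star newton_isoK.
  exact: tau_ge0.
have LcD p q : Lc (p + q) = Lc p + Lc q by rewrite -[p]scale1r Lclin mul1r scale1r.
have Lc_real p : complex.Im (Lc p) = 0.
  have h0 (q : {poly R}) : (forall x, 0 < q.[x]) -> complex.Im (Lc q) = 0.
    by move=> /Lc_pos; rewrite lecE => /andP[/eqP].
  (* [p] is a difference of two strictly positive polynomials. *)
  have hp : Lc (p ^+ 2 + p + 1%:P) = Lc p + Lc (p ^+ 2 + 1%:P).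
    by rewrite -LcD; congr Lc; ring.
  have h1 : complex.Im (Lc (p ^+ 2 + p + 1%:P)) = 0.
    by apply: h0 => x; rewrite !hornerD horner_exp hornerC; nra.
  have h2 : complex.Im (Lc (p ^+ 2 + 1%:P)) = 0.
    by apply: h0 => x; rewrite hornerD horner_exp hornerC; nra.
  by move: h1; rewrite hp ImD h2 addr0.
have Lc1 : 0 <= Lc 1%:P by apply: Lc_pos => x; rewrite hornerC.
exists (fun p => complex.Re (Lc p)); split.
- by move=> a p q; rewrite Lclin ReD Re_realM.
- move=> p p_ge0; apply: (@le_of_le_divn _ _ _ (complex.Re (Lc 1%:P))) => n.
  have := Lc_pos (n.+1%:R^-1 *: 1%:P + p).
  rewrite Lclin lecE ReD Re_realM => h.
  have /h/andP[_] : forall x, 0 < (n.+1%:R^-1 *: 1%:P + p).[x].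
    by move=> x; rewrite hornerD hornerZ hornerC mulr1 ltr_wpDr// invr_gt0.
  by rewrite addrC mulrC.
- move=> n; rewrite -realC_eq// /Lc map_newton; exact/esym/poly_functional_newton.
Qed.

End pairing.

(** Each term is at most the sum [S]. Taking [S + 1] and [2 ^+ q] in place of their natural square
    roots avoids roots and also gives [1 <= M], on which the passage to powers relies. *)
Lemma l2_minus_bound (R : realType) (xi : nat -> R[i]) : l2_minus xi ->
  exists C M : R, [/\ 0 <= C, 1 <= M &
    forall n, Normc.normc (xi n) <= C * M ^+ n * n`!%:R].
Proof.
move=> [q hsum].
pose u n : \bar R := (Normc.normc (xi n) ^+ 2 * n`!%:R ^- 2 * 2 ^- (q * n))%:E.
rewrite -/u in hsum.
have u0 n : 0 <= Normc.normc (xi n) ^+ 2 * n`!%:R ^- 2 * 2 ^- (q * n).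
  by rewrite mulr_ge0 ?invr_ge0 ?exprn_ge0// mulr_ge0 ?sqr_ge0// invr_ge0 exprn_ge0.
have sum_ge0 : (0 <= \sum_(0 <= n <oo) u n)%E.
  by apply: nneseries_ge0 => n _ _; rewrite lee_fin.
have fin : (\sum_(0 <= n <oo) u n)%E \is a fin_num by rewrite ge0_fin_numE.
pose S := fine (\sum_(0 <= n <oo) u n)%E.
have S0 : 0 <= S by exact: fine_ge0.
exists (S + 1), (2 ^+ q); split; [by lra|by rewrite exprn_ege1// ler1n|move=> n].
have uS : Normc.normc (xi n) ^+ 2 * n`!%:R ^- 2 * 2 ^- (q * n) <= S.
  rewrite -lee_fin /S fineK//.
  apply: le_trans (nneseries_lim_ge n.+1 _); last first.
    by move=> k _ _; rewrite lee_fin.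
  by rewrite big_nat_recr//= leeDr// sume_ge0// => i _; rewrite lee_fin.
have P0 : 0 < (2 ^+ q) ^+ n * n`!%:R :> R.
  by rewrite mulr_gt0 ?exprn_gt0// ltr0n fact_gt0.
rewrite -mulrA -(@ler_pXn2r _ 2)//; last 2 first.
- by rewrite nnegrE; case: (xi n) => a b; exact: sqrtr_ge0.
- by rewrite nnegrE mulr_ge0 ?(ltW P0)//; lra.
have h : Normc.normc (xi n) ^+ 2 <= S * (n`!%:R ^+ 2 * 2 ^+ (q * n)).
  rewrite -ler_pdivrMr ?mulr_gt0 ?exprn_gt0 ?ltr0n ?fact_gt0//.
  by rewrite invfM mulrA.
apply: le_trans h _; rewrite exprMn exprMn -exprM.
have S2 : S <= (S + 1) ^+ 2 by nra.
apply: (@le_trans _ _ ((S + 1) ^+ 2 * (n`!%:R ^+ 2 * 2 ^+ (q * n)))).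
  by apply: ler_wpM2r => //; rewrite mulr_ge0 ?sqr_ge0 ?exprn_ge0.
rewrite [in leRHS]mulrC [_ ^+ 2 * 2 ^+ _]mulrC [leRHS]mulrC.
apply: ler_wpM2l; first exact: sqr_ge0.
apply: ler_wpM2r; first exact: sqr_ge0.
rewrite -[in leRHS]exprM; apply: ler_weXn2l; first by rewrite ler1n.
by rewrite leq_pmulr.
Qed.

(* [x (x)_k = (x)_{k+1} + k (x)_k]: the induction on [n] must be uniform in
   the index of the Newton factor. *)
Lemma moment_growth (R : realType) (L : {poly R} -> R) (C M : R) :
  (forall a p q, L (a *: p + q) = a * L p + L q) -> 0 <= C -> 1 <= M ->
  (forall n, `|L (newton R n)| <= C * M ^+ n * n`!%:R) ->
  forall n k, `|L ('X^n * newton R k)| <= C * (2 * M) ^+ n * M ^+ k * (n + k)`!%:R.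
Proof.
move=> Llin C0 M1 LN; have M0 : 0 <= M by lra.
elim=> [|n IH] k; first by rewrite mul1r expr0 mulr1.
have -> : 'X^(n.+1) * newton R k =
    k%:R *: ('X^n * newton R k) + 'X^n * newton R k.+1 :> {poly R}.
  by rewrite exprSr -mulrA mulX_newton -!mul_polyC; ring.
rewrite Llin; apply: le_trans (ler_normD _ _) _.
rewrite normrM ger0_norm//.
set A := C * (2 * M) ^+ n * M ^+ k.
have A0 : 0 <= A by rewrite /A !mulr_ge0// exprn_ge0// mulr_ge0.
have f0 : 0 <= (n + k).+1`!%:R :> R by [].
(* Both summands are at most [A * M] times (n+k+1)!, here because [k <= n + k + 1] is absorbed by
   the factorial; hence a factor [2 * M] for each power of [x]. *)
have h1 : k%:R * `|L ('X^n * newton R k)| <= A * M * (n + k).+1`!%:R.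
  apply: (@le_trans _ _ (k%:R * (A * (n + k)`!%:R))); first exact: ler_wpM2l.
  rewrite factS natrM mulrCA -[A * M * _]mulrA; apply: ler_wpM2l => //.
  rewrite mulrA; apply: ler_wpM2r => //.
  apply: (@le_trans _ _ (1 * (n + k).+1%:R)).
    by rewrite mul1r ler_nat (leq_trans (leq_addl n k)).
  by apply: ler_wpM2r.
have h2 : `|L ('X^n * newton R k.+1)| <= A * M * (n + k).+1`!%:R.
  apply: le_trans (IH k.+1) _; rewrite addnS exprSr /A le_eqVlt; apply/orP; left.
  by apply/eqP; ring.
apply: le_trans (lerD h1 h2) _; rewrite le_eqVlt addSn; apply/orP; left.
by apply/eqP; rewrite exprSr /A; ring.
Qed.

(** * Exponential moments and Laplace transforms *)

Lemma series_exp_coeff_sumE (R : realType) (x : R) n :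
  series (exp_coeff x) n = \sum_(k < n) x ^+ k / k`!%:R.
Proof. by rewrite seriesEord. Qed.

Lemma cvg_expR_series (R : realType) (x : R) :
  \sum_(k < n) x ^+ k / k`!%:R @[n --> \oo] --> expR x.
Proof.
rewrite (_ : (fun n : nat => _) = series (exp_coeff x)).
  exact: is_cvg_series_exp_coeff.
by apply: funext => n; rewrite series_exp_coeff_sumE.
Qed.

Lemma measurable_expR_abs (R : realType) (e : R) :
  measurable_fun (setT : set (measurableTypeR R)) (fun x : R => expR (e * `|x|)).
Proof.
by apply: measurableT_comp => //; apply: measurable_funM.
Qed.

Lemma expR_abs_le (R : realType) (e x : R) : 0 <= e ->
  expR (e * `|x|) <= expR (e * x) + expR (- (e * x)).
Proof.
move=> e0; have := expR_ge0 (e * x); have := expR_ge0 (- (e * x)).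
have [x0|x0] := ger0P x; first by lra.
by rewrite mulrN; lra.
Qed.

Section exponential_moments.
Variables (R : realType) (mu : {finite_measure set (measurableTypeR R) -> \bar R}).

(** The partial sums of [2 cosh (e x)] are nonnegative polynomials. With [e * B = 1 / 2] the
    factorials cancel and their integrals are bounded by a geometric series of sum [4 C]; Fatou's
    lemma does the rest. *)
Lemma integrable_expR_of_moments (C B : R) : 0 <= C -> 0 < B ->
  (forall p, mu.-integrable setT (EFin \o horner p)) ->
  (forall n, `|\int[mu]_x x ^+ n| <= C * B ^+ n * n`!%:R) ->
  exists2 e, 0 < e & mu.-integrable setT (fun x => (expR (e * `|x|))%:E).
Proof.
move=> C0 B0 Ip mom; pose e := (2 * B)^-1.
have e0 : 0 < e by rewrite invr_gt0 mulr_gt0.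
exists e => //.
(* Taylor coefficients of [2 cosh (e x)], zero for odd [n]. *)
pose c n : R := (e ^+ n + (- e) ^+ n) / n`!%:R.
have c_bnd n : `|c n| <= 2 * e ^+ n / n`!%:R.
  rewrite /c normrM [`|_^-1|]ger0_norm ?invr_ge0//; apply: ler_wpM2r; first by rewrite invr_ge0.
  apply: le_trans (ler_normD _ _) _; rewrite !normrX normrN ger0_norm ?(ltW e0)//.
  by rewrite mulr_natl mulr2n.
have cE n x : c n * x ^+ n = (e * x) ^+ n / n`!%:R + (- (e * x)) ^+ n / n`!%:R.
  by rewrite -mulNr !exprMn /c; ring.
have t_ge0 n (x : R) : 0 <= c n * x ^+ n.
  rewrite cE -mulrDl mulr_ge0 ?invr_ge0// exprNn -[X in X + _]mul1r -mulrDl.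
  rewrite -signr_odd; case: (boolP (odd n)) => on; first by rewrite expr1 subrr mul0r.
  by rewrite expr0 mulr_ge0// real_exprn_even_ge0// num_real.
pose P N : {poly R} := \poly_(n < N) c n.
have PE N x : (P N).[x] = \sum_(k < N) c k * x ^+ k.
  by rewrite /P horner_poly.
have P_ge0 N x : 0 <= (P N).[x] by rewrite PE sumr_ge0.
have IX n : mu.-integrable setT (EFin \o (fun x : R => x ^+ n)).
  by rewrite (_ : (fun x : R => _) = horner 'X^n)//; apply: funext => x; rewrite hornerXn.
have IPE N : \int[mu]_x (P N).[x] = \sum_(k < N) c k * \int[mu]_x x ^+ k.
  elim: N => [|N IH].
    rewrite big_ord0 -[RHS](mul0r (fine (mu setT))) -(Rintegral_cst mu measurableT).
    by apply: eq_Rintegral => x _; rewrite PE big_ord0.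
  rewrite big_ord_recr/= -IH -(RintegralZl _ measurableT (IX N)).
  rewrite -(RintegralD measurableT (Ip (P N)) (integrable_scaler (c N) (IX N))).
  by apply: eq_Rintegral => x _; rewrite !PE big_ord_recr.
have ndI : nondecreasing_seq (fun N => \int[mu]_x (P N).[x]).
  apply/nondecreasing_seqP => N; apply: le_Rintegral => //; [exact: Ip..|].
  by move=> x _; rewrite !PE big_ord_recr/= lerDl.
have ubI N : \int[mu]_x (P N).[x] <= 4 * C.
  rewrite IPE; apply: (@le_trans _ _ (\sum_(k < N) 2 * C * (2^-1) ^+ k)).
    apply: ler_sum => k _; apply: le_trans (ler_norm _) _; rewrite normrM.
    apply: (@le_trans _ _ ((2 * e ^+ k / k`!%:R) * (C * B ^+ k * k`!%:R))).
      exact: ler_pM.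
    have f0 : k`!%:R != 0 :> R by rewrite pnatr_eq0 -lt0n fact_gt0.
    have eB : e * B = 2^-1 by rewrite /e; field; rewrite gt_eqF.
    rewrite -eB exprMn le_eqVlt; apply/orP; left; apply/eqP; field.
    by [].
  rewrite -mulr_sumr.
  have -> : \sum_(k < N) (2^-1 : R) ^+ k = 2 - 2 * 2^-1 ^+ N.
    elim: N => [|N IH]; first by rewrite big_ord0 expr0; lra.
    by rewrite big_ord_recr/= IH exprS; field.
  have : 0 <= (2^-1 : R) ^+ N by rewrite exprn_ge0// invr_ge0.
  by nra.
have cvgI : cvgn (fun N => \int[mu]_x (P N).[x]).
  apply: nondecreasing_is_cvgn => //; exists (4 * C) => _ [N _ <-]; exact: ubI.
have Isum : mu.-integrable setT (EFin \o (fun x : R => expR (e * x) + expR (- (e * x)))).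
  apply: (integrable_of_cvg_Rintegral (fun N => Ip (P N)) P_ge0 _ cvgI) => x.
  rewrite (_ : (fun N => _) = (fun N => \sum_(k < N) (e * x) ^+ k / k`!%:R +
      \sum_(k < N) (- (e * x)) ^+ k / k`!%:R)).
    by apply: cvgD; exact: cvg_expR_series.
  by apply: funext => N; rewrite PE -big_split; apply: eq_bigr => k _; rewrite cE.
apply: (integrable_le_norm (measurable_expR_abs e) _ Isum) => x.
by rewrite ger0_norm ?expR_ge0//; exact/expR_abs_le/ltW.
Qed.

End exponential_moments.

(** * Estimates for the real exponential, sine and cosine *)

Section elementary_bounds.
Variable R : realType.
Implicit Types a b x y : R.

Lemma norm_expR_sub1 a : `|expR a - 1| <= `|a| * expR `|a|.
Proof.
have h1 := expR_ge1Dx a; have h2 := expR_ge1Dx (- a).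
have h3 : expR (- a) * expR a = 1 by rewrite mulrC expRxMexpNx_1.
have ea := expR_gt0 a; have ena := expR_gt0 (- a).
(* This is [1 - a <= expR (- a)] multiplied by [expR a]. *)
have h4 : expR a - 1 <= a * expR a by nra.
have [a0|a0] := ger0P a; first by rewrite ger0_norm; lra.
by rewrite ler0_norm; nra.
Qed.

Lemma norm_expR_sub1D a : `|expR a - 1 - a| <= a ^+ 2 * expR `|a|.
Proof.
have h1 := expR_ge1Dx a; have h2 := expR_ge1Dx (- a).
have h3 : expR (- a) * expR a = 1 by rewrite mulrC expRxMexpNx_1.
have ea := expR_gt0 a; have ena := expR_gt0 (- a).
have h4 : expR a - 1 - a <= a * (expR a - 1) by nra.
rewrite ger0_norm; last by lra.
have [a0|a0] := ger0P a; first by nra.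
have : 1 <= expR (- a) by lra.
by nra.
Qed.

(** The trigonometric bounds follow by integrating one another: [cos] bounds [sin], [sin] bounds
    [cos - 1], and [cos - 1] bounds [sin x - x]. *)
Lemma norm_sub_le_MVT (f df : R -> R) (K x : R) :
  (forall y, is_derive y 1 f (df y)) ->
  (forall y, `|y| <= `|x| -> `|df y| <= K) -> `|f x - f 0| <= K * `|x|.
Proof.
move=> fd dfK.
have cf : continuous f.
  by move=> y; apply/differentiable_continuous/derivable1_diffP; have [] := fd y.
have [x0|x0] := leP 0 x.
  have [c] := MVT_segment x0 (fun y _ => fd y) (continuous_subspaceT cf).
  rewrite in_itv/= => /andP[c0 cx] ->; rewrite subr0 normrM.
  by apply: ler_wpM2r => //; apply: dfK; rewrite !ger0_norm.
have [c] := MVT_segment (ltW x0) (fun y _ => fd y) (continuous_subspaceT cf).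
rewrite in_itv/= => /andP[cx c0]; rewrite distrC => ->; rewrite sub0r normrM normrN.
by apply: ler_wpM2r => //; apply: dfK; rewrite !ler0_norm ?(ltW x0)// lerN2.
Qed.

Lemma norm_sin_le x : `|sin x| <= `|x|.
Proof.
rewrite -[sin x]subr0 -sin0 -[leRHS]mul1r.
by apply: (norm_sub_le_MVT (df := cos)) => // y _; exact: cos_max.
Qed.

Lemma norm_cos_sub1 x : `|cos x - 1| <= x ^+ 2.
Proof.
rewrite -cos0 -(real_normK (num_real x)) expr2.
apply: (norm_sub_le_MVT (df := fun y => - sin y)) => y yx.
by rewrite normrN (le_trans (norm_sin_le y)).
Qed.

Lemma norm_sin_sub x : `|sin x - x| <= `|x| * x ^+ 2.
Proof.
have := @norm_sub_le_MVT (fun y => sin y - y) (fun y => cos y - 1) (x ^+ 2) x.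
rewrite sin0 subr0 subr0 mulrC; apply => y yx.
apply: le_trans (norm_cos_sub1 y) _.
by rewrite -(real_normK (num_real x)) -(real_normK (num_real y)) lerXn2r.
Qed.

(** Quadratic on the whole line: the cubic bound for [|x| <= 1], the trivial bound [2 |x|]
    beyond. *)
Lemma norm_sin_sub2 x : `|sin x - x| <= 2 * x ^+ 2.
Proof.
have h := norm_sin_sub x; have x2 := real_normK (num_real x).
have [x1|x1] := leP `|x| 1.
  by apply: le_trans h _; rewrite -x2; have := normr_ge0 x; nra.
by apply: le_trans (ler_normB _ _) _; have := norm_sin_le x; rewrite -x2; nra.
Qed.

Lemma sqr_le_expR e x : 0 < e -> x ^+ 2 <= 2 / e ^+ 2 * expR (e * `|x|).
Proof.
move=> e0; have := @expR_ge1Dxn _ (e * `|x|) 1 (mulr_ge0 (ltW e0) (normr_ge0 x)).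
rewrite exprMn (real_normK (num_real x)) (_ : 1.+1`! = 2%N)// => h.
rewrite mulrAC ler_pdivlMr ?exprn_gt0//.
by move: h; rewrite mulrC => h; nra.
Qed.

End elementary_bounds.

Section cexp.
Variable R : realType.
Implicit Types z w : R[i].

(** Real valued, whereas [|z|] lies in [R[i]], and split along real and imaginary parts as the
    integrals are; equivalent to the modulus within a factor 2. *)
Definition norm1 z : R := `|complex.Re z| + `|complex.Im z|.

Lemma cexpD z w : cexp (z + w) = cexp z * cexp w.
Proof.
rewrite /cexp ReD ImD expRD cosD sinD; apply/eqP; rewrite eq_complex/=.
by apply/andP; split; apply/eqP; ring.
Qed.

Lemma norm1M_le z w : norm1 (z * w) <= norm1 z * norm1 w.
Proof.
case: z w => [a b] [c d]; rewrite /norm1/=.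
rewrite mulrDl !mulrDr -!normrM.
have := ler_normB (a * c) (b * d); have := ler_normD (a * d) (b * c); lra.
Qed.

Lemma norm1_cexp z : norm1 (cexp z) <= 2 * expR (complex.Re z).
Proof.
rewrite /norm1/= !normrM ger0_norm ?expR_ge0// -mulrDr mulrC.
apply: ler_wpM2r; first exact: expR_ge0.
by have := cos_max (complex.Im z); have := sin_max (complex.Im z); lra.
Qed.

(** Valid on the whole plane, so that at [x h] it can be integrated in [x]: the remainder is
    quadratic in [h], and the exponential factor is left to the exponential moment. *)
Lemma norm1_cexp_sub1D z :
  norm1 (cexp z - 1 - z) <= 4 * norm1 z ^+ 2 * expR `|complex.Re z|.
Proof.
case: z => a b; rewrite /norm1/=.
have := norm_expR_sub1 a; have := norm_expR_sub1D a.
have := norm_cos_sub1 b; have := norm_sin_sub2 b.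
have ea : expR a <= expR `|a| by rewrite ler_expR ler_norm.
have ea0 := expR_gt0 a.
have e1 : 1 <= expR `|a| by rewrite -expR0 ler_expR.
set E := expR `|a| in ea e1 *; move=> h1 h2 h3 h4.
have a2 := real_normK (num_real a); have b2 := real_normK (num_real b).
have hre : `|expR a * cos b - 1 - a| <= E * (a ^+ 2 + b ^+ 2).
  rewrite (_ : _ - _ - _ = (expR a - 1 - a) + expR a * (cos b - 1)); last by ring.
  apply: le_trans (ler_normD _ _) _; rewrite normrM (ger0_norm (ltW ea0)).
  have : expR a * `|cos b - 1| <= E * b ^+ 2 by apply: ler_pM => //; exact: ltW.
  by lra.
have him : `|expR a * sin b - 0 - b| <= E * (2 * b ^+ 2 + `|a| * `|b|).
  rewrite (_ : _ - _ - _ = expR a * (sin b - b) + (expR a - 1) * b); last by ring.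
  apply: le_trans (ler_normD _ _) _; rewrite !normrM (ger0_norm (ltW ea0)).
  have : expR a * `|sin b - b| <= E * (2 * b ^+ 2) by apply: ler_pM => //; exact: ltW.
  have : `|expR a - 1| * `|b| <= (`|a| * E) * `|b| by apply: ler_wpM2r.
  by lra.
rewrite -a2 -b2 in hre him.
have := normr_ge0 a; have := normr_ge0 b; move: (`|a|) (`|b|) hre him => u v hre him v0 u0.
apply: le_trans (lerD hre him) _; rewrite -mulrDr mulrC.
apply: ler_wpM2r; [lra|nra].
Qed.

Lemma normr_le_norm1 z : `|z| <= (norm1 z)%:C.
Proof.
rewrite normc_def lecR; case: z => a b; rewrite /norm1/=.
rewrite -[leRHS]ger0_norm ?addr_ge0// -sqrtr_sqr ler_wsqrtr//.
rewrite -(real_normK (num_real a)) -(real_normK (num_real b)).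
by have := normr_ge0 a; have := normr_ge0 b; nra.
Qed.

Lemma norm1_le_normr z : (norm1 z)%:C <= 2%:R * `|z|.
Proof.
rewrite normc_def; case: z => a b; rewrite /norm1/=.
have -> : 2%:R * (Num.sqrt (a ^+ 2 + b ^+ 2))%:C = (2 * Num.sqrt (a ^+ 2 + b ^+ 2))%:C :> R[i].
  by rewrite rmorphM/= rmorph_nat.
rewrite lecR mulr2n mulrDl !mul1r lerD// -sqrtr_sqr ler_wsqrtr//.
  by rewrite lerDl sqr_ge0.
by rewrite lerDr sqr_ge0.
Qed.

End cexp.

Lemma near_norm1 (R : realType) (z0 : R[i]) (d : R) : 0 < d ->
  \forall z \near (z0 : R[i]^o), norm1 (z - z0) <= d.
Proof.
move=> d0; apply/nbhs_ballP; exists (d / 2)%:C => /=.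
  by rewrite ltcR divr_gt0.
move=> z; rewrite /ball/= => zz0; rewrite -lecR.
apply: le_trans (norm1_le_normr _) _; rewrite distrC.
apply: (@le_trans _ _ (2%:R * (d / 2)%:C)); first by apply: ler_wpM2l => //; exact: ltW.
rewrite le_eqVlt; apply/orP; left; apply/eqP.
by rewrite -(rmorph_nat (real_complex R)) -rmorphM/=; congr (_ %:C); field.
Qed.

(** * Integrals of complex-valued functions *)

Section complex_integrals.
Variables (R : realType) (mu : {finite_measure set (measurableTypeR R) -> \bar R}).
Implicit Types (F G : R -> R[i]) (g : R -> R).

Lemma cintegrable_le F g :
  measurable_fun (setT : set (measurableTypeR R)) (fun x => complex.Re (F x)) ->
  measurable_fun (setT : set (measurableTypeR R)) (fun x => complex.Im (F x)) ->
  (forall x, norm1 (F x) <= g x) -> mu.-integrable setT (EFin \o g) ->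
  cintegrable mu F.
Proof.
move=> mRe mIm Fg Ig; split; [apply: integrable_le_norm mRe _ Ig|
  apply: integrable_le_norm mIm _ Ig] => x; apply: le_trans (Fg x).
  by rewrite lerDl.
by rewrite lerDr.
Qed.

Lemma cintegralD F G : cintegrable mu F -> cintegrable mu G ->
  cintegrable mu (fun x => F x + G x) /\
  cintegral mu (fun x => F x + G x) = cintegral mu F + cintegral mu G.
Proof.
move=> [IF1 IF2] [IG1 IG2]; split.
  split.
    rewrite (_ : (fun x => _) =
      EFin \o ((fun x => complex.Re (F x)) + (fun x => complex.Re (G x)))).
      exact: integrable_addr.
    by apply: funext => x /=; rewrite ReD.
  rewrite (_ : (fun x => _) =
    EFin \o ((fun x => complex.Im (F x)) + (fun x => complex.Im (G x)))).
    exact: integrable_addr.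
  by apply: funext => x /=; rewrite ImD.
rewrite /cintegral; apply/eqP; rewrite eq_complex/=; apply/andP; split; apply/eqP.
  by rewrite -RintegralD//; apply: eq_Rintegral => x _; rewrite ReD.
by rewrite -RintegralD//; apply: eq_Rintegral => x _; rewrite ImD.
Qed.

Lemma cintegralZ (c : R[i]) F : cintegrable mu F ->
  cintegrable mu (fun x => c * F x) /\
  cintegral mu (fun x => c * F x) = c * cintegral mu F.
Proof.
move=> [IF1 IF2]; pose F1 x := complex.Re (F x); pose F2 x := complex.Im (F x).
case: c => a b.
have E1 x : complex.Re ((a +i* b) * F x) = (a *: F1 + (- b) *: F2) x.
  rewrite /F1 /F2 [RHS](_ : _ = a * complex.Re (F x) + - b * complex.Im (F x))//.
  by case: (F x) => u v /=; ring.
have E2 x : complex.Im ((a +i* b) * F x) = (a *: F2 + b *: F1) x.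
  rewrite /F1 /F2 [RHS](_ : _ = a * complex.Im (F x) + b * complex.Re (F x))//.
  by case: (F x) => u v /=; ring.
have IZ1 (r : R) : mu.-integrable setT (EFin \o (r *: F1)) by exact: integrable_scaler.
have IZ2 (r : R) : mu.-integrable setT (EFin \o (r *: F2)) by exact: integrable_scaler.
split.
  split.
    by under eq_fun do rewrite E1; exact: integrable_addr.
  by under eq_fun do rewrite E2; exact: integrable_addr.
rewrite /cintegral; under eq_Rintegral do rewrite E1.
rewrite (Rintegral_addr (IZ1 _) (IZ2 _)) !Rintegral_scaler//.
under [X in _ +i* X = _]eq_Rintegral do rewrite E2.
rewrite (Rintegral_addr (IZ2 _) (IZ1 _)) !Rintegral_scaler//.
by apply/eqP; rewrite eq_complex/=; apply/andP; split; apply/eqP; rewrite ?mulNr.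
Qed.

Lemma norm1_cintegral_le F g : cintegrable mu F -> mu.-integrable setT (EFin \o g) ->
  (forall x, norm1 (F x) <= g x) ->
  norm1 (cintegral mu F) <= 2 * \int[mu]_x g x.
Proof.
move=> [IF1 IF2] Ig Fg; rewrite mulr2n mulrDl mul1r; apply: lerD => /=.
  apply: le_trans (le_normr_Rintegral _ IF1) _ => //.
  apply: le_Rintegral => //; first exact: (integrable_norm IF1).
  by move=> x _; apply: le_trans (Fg x); rewrite lerDl.
apply: le_trans (le_normr_Rintegral _ IF2) _ => //.
apply: le_Rintegral => //; first exact: (integrable_norm IF2).
by move=> x _; apply: le_trans (Fg x); rewrite lerDr.
Qed.

End complex_integrals.

Section analytic_measure.
Variables (R : realType) (mu : {finite_measure set (measurableTypeR R) -> \bar R}).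

Lemma Re_cexpM (x : R) (z : R[i]) : complex.Re (cexp (x%:C * z)) =
  expR (x * complex.Re z) * cos (x * complex.Im z).
Proof. by rewrite /cexp Re_realM Im_realM. Qed.

Lemma Im_cexpM (x : R) (z : R[i]) : complex.Im (cexp (x%:C * z)) =
  expR (x * complex.Re z) * sin (x * complex.Im z).
Proof. by rewrite /cexp Re_realM Im_realM. Qed.

Lemma measurable_Re_cexpM (p : {poly R}) (z : R[i]) :
  measurable_fun (setT : set (measurableTypeR R))
    (fun x : R => complex.Re (p.[x]%:C * cexp (x%:C * z))).
Proof.
under eq_fun do rewrite Re_realM Re_cexpM.
apply: measurable_funM; first exact: measurable_poly.
apply: measurable_funM.
  by apply: measurableT_comp => //; exact: measurable_funM.
apply: (@measurableT_comp _ _ _ _ _ _ (@cos R)); last exact: measurable_funM.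
by apply: continuous_measurable_fun; exact: continuous_cos.
Qed.

Lemma measurable_Im_cexpM (p : {poly R}) (z : R[i]) :
  measurable_fun (setT : set (measurableTypeR R))
    (fun x : R => complex.Im (p.[x]%:C * cexp (x%:C * z))).
Proof.
under eq_fun do rewrite Im_realM Im_cexpM.
apply: measurable_funM; first exact: measurable_poly.
apply: measurable_funM.
  by apply: measurableT_comp => //; exact: measurable_funM.
apply: (@measurableT_comp _ _ _ _ _ _ (@sin R)); last exact: measurable_funM.
by apply: continuous_measurable_fun; exact: continuous_sin.
Qed.

Lemma norm1_cexpM (e x : R) (z : R[i]) : `|complex.Re z| <= e ->
  norm1 (cexp (x%:C * z)) <= 2 * expR (e * `|x|).
Proof.
move=> ze; apply: le_trans (norm1_cexp _) _; apply: ler_wpM2l => //.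
rewrite ler_expR Re_realM; apply: le_trans (ler_norm _) _.
by rewrite normrM mulrC ler_wpM2r.
Qed.

Lemma norm1_real (x : R) : norm1 x%:C = `|x|.
Proof. by rewrite /norm1/= normr0 addr0. Qed.

(** The derivative at [z] is the integral of [x exp (x z)], with an error quadratic in [h]. For [z]
    and [h] of size at most [e / 4], [exp (x z)] and the Taylor remainder each use a quarter of the
    exponent, and the remaining half absorbs [x^2]. *)
Lemma analytic_measure_of_expR (e : R) : 0 < e ->
  mu.-integrable setT (fun x => (expR (e * `|x|))%:E) -> analytic_measure mu.
Proof.
move=> e0 Ie; pose E (x : R) := expR (e * `|x|).
have IE (c : R) : mu.-integrable setT (EFin \o (c *: E)).
  exact: integrable_scaler.
have e4 : 0 < e / 4 by rewrite divr_gt0.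
have Re_norm1 (z : R[i]) : `|complex.Re z| <= norm1 z by rewrite lerDl.
have Icexp (z : R[i]) : `|complex.Re z| <= e ->
    cintegrable mu (fun x => cexp (x%:C * z)).
  move=> ze.
  have -> : (fun x : R => cexp (x%:C * z)) = (fun x => (1%:P : {poly R}).[x]%:C * cexp (x%:C * z)).
    by apply: funext => x; rewrite hornerC mul1r.
  apply: (cintegrable_le (measurable_Re_cexpM _ _) (measurable_Im_cexpM _ _) _ (IE 2)).
  by move=> x; rewrite hornerC mul1r; exact: norm1_cexpM.
have x2E x : x ^+ 2 * expR (e / 2 * `|x|) <= 8 / e ^+ 2 * E x.
  have e2 : 0 < e / 2 by rewrite divr_gt0.
  have := ler_wpM2r (expR_ge0 (e / 2 * `|x|)) (sqr_le_expR x e2).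
  rewrite -[X in _ <= X]mulrA -expRD -mulrDl -splitr => /le_trans; apply.
  by rewrite le_eqVlt; apply/orP; left; apply/eqP; rewrite /E; field; rewrite gt_eqF.
split.
  apply: filterS (near_norm1 0 e0) => z; rewrite subr0 => ze.
  by apply: Icexp; apply: le_trans ze.
rewrite /holomorphic_at; apply: filterS (near_norm1 0 e4) => z; rewrite subr0 => ze4.
have ze : `|complex.Re z| <= e / 4 := le_trans (Re_norm1 z) ze4.
have IX : cintegrable mu (fun x => x%:C * cexp (x%:C * z)).
  have -> : (fun x : R => x%:C * cexp (x%:C * z)) =
      (fun x => ('X : {poly R}).[x]%:C * cexp (x%:C * z)).
    by apply: funext => x; rewrite hornerX.
  apply: (cintegrable_le (measurable_Re_cexpM _ _) (measurable_Im_cexpM _ _) _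
    (IE (2 * (1 + 8 / e ^+ 2)))) => x.
  rewrite hornerX; apply: le_trans (norm1M_le _ _) _; rewrite norm1_real.
  have := norm1_cexpM x (le_trans ze (_ : e / 4 <= e / 2)) => /(_ _)/(ler_wpM2l (normr_ge0 x)) h.
  apply: le_trans (h _) _; first by lra.
  rewrite [leRHS](_ : _ = 2 * (1 + 8 / e ^+ 2) * E x)// [X in X <= _]mulrCA -[X in _ <= X]mulrA.
  apply: ler_wpM2l => //; rewrite mulrDl mul1r.
  have h2 := x2E x.
  have h3 : expR (e / 2 * `|x|) <= E x.
    by rewrite ler_expR; apply: ler_wpM2r => //; lra.
  have := expR_gt0 (e / 2 * `|x|); have := normr_ge0 x.
  move: h2; rewrite -(real_normK (num_real x)).
  move: (8 / _ * _) => w; move: `|x| (expR _) h3 => u v h3 h2 u0 v0.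
  have := mulr_ge0 (ltW v0) (sqr_ge0 (u - 1)); have := mulr_ge0 u0 (ltW v0).
  by nra.
set D := cintegral mu (fun x => x%:C * cexp (x%:C * z)).
(* 64 is 4 from the Taylor remainder, 2 from [norm1_cexpM] and 8 from [x2E]; the outer 2 comes from
   bounding real and imaginary parts separately. *)
pose K := 2 * (64 / e ^+ 2 * \int[mu]_x E x).
have K0 : 0 <= K.
  rewrite mulr_ge0// mulr_ge0//; first by rewrite divr_ge0// exprn_ge0// ltW.
  by apply: Rintegral_ge0 => x _; exact: expR_ge0.
have main (h : R[i]) : norm1 h <= e / 4 ->
    norm1 (laplace mu (h + z) - laplace mu z - h * D) <= K * norm1 h ^+ 2.
  move=> he4; have he : `|complex.Re h| <= e / 4 := le_trans (Re_norm1 h) he4.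
  have zhe : `|complex.Re (h + z)| <= e.
    by rewrite ReD; apply: le_trans (ler_normD _ _) _; lra.
  have ze1 : `|complex.Re z| <= e by lra.
  have I1 := Icexp _ zhe.
  have [I2 E2] := cintegralZ (-1) (Icexp z ze1).
  have [I3 E3] := cintegralZ (- h) IX.
  have [I4 E4] := cintegralD I1 I2.
  have [I5 E5] := cintegralD I4 I3.
  pose c := 64 / e ^+ 2 * norm1 h ^+ 2.
  have -> : K * norm1 h ^+ 2 = 2 * \int[mu]_x (c *: E) x.
    by rewrite Rintegral_scaler// /K /c; ring.
  have -> : laplace mu (h + z) - laplace mu z - h * D = cintegral mu (fun x =>
      cexp (x%:C * (h + z)) + -1 * cexp (x%:C * z) + - h * (x%:C * cexp (x%:C * z))).
    by rewrite E5 E4 E3 E2 mulN1r mulNr.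
  apply: norm1_cintegral_le => // x.
  have -> : cexp (x%:C * (h + z)) + -1 * cexp (x%:C * z) + - h * (x%:C * cexp (x%:C * z)) =
      (cexp (x%:C * h) - 1 - x%:C * h) * cexp (x%:C * z).
    by rewrite mulrDr cexpD; ring.
  apply: le_trans (norm1M_le _ _) _.
  have b1 := norm1_cexpM x ze.
  have b2 := norm1_cexp_sub1D (x%:C * h).
  have b3 : norm1 (x%:C * h) ^+ 2 <= x ^+ 2 * norm1 h ^+ 2.
    rewrite -(real_normK (num_real x)) -exprMn -norm1_real.
    by rewrite lerXn2r ?nnegrE ?addr_ge0 ?mulr_ge0 ?addr_ge0// norm1M_le.
  have b4 : expR `|complex.Re (x%:C * h)| <= expR (e / 4 * `|x|).
    by rewrite ler_expR Re_realM normrM mulrC ler_wpM2r.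
  have n0 (w : R[i]) : 0 <= norm1 w by rewrite addr_ge0.
  apply: le_trans (ler_pM (n0 _) (n0 _) b2 b1) _.
  apply: (@le_trans _ _ (4 * (x ^+ 2 * norm1 h ^+ 2) * expR (e / 4 * `|x|) *
      (2 * expR (e / 4 * `|x|)))).
    apply: ler_wpM2r; first by rewrite mulr_ge0 ?expR_ge0.
    apply: ler_pM; rewrite ?expR_ge0 ?mulr_ge0 ?exprn_ge0//.
    by apply: ler_wpM2l.
  have eE : expR (e / 4 * `|x|) * expR (e / 4 * `|x|) = expR (e / 2 * `|x|).
    by rewrite -expRD; congr expR; field.
  rewrite (_ : _ * _ = 8 * norm1 h ^+ 2 * (x ^+ 2 * expR (e / 2 * `|x|)));
    last by rewrite -eE; ring.
  apply: le_trans (ler_wpM2l _ (x2E x)) _; first by rewrite mulr_ge0 ?exprn_ge0.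
  rewrite [leRHS](_ : _ = c * E x)// /c le_eqVlt; apply/orP; left; apply/eqP.
  by field; rewrite gt_eqF.
apply/cvg_ex; exists (D : R[i]^o); apply/cvgrPdist_le => /= eps eps0.
(* A positive element of [R[i]] is real. *)
have [eps_im eps_re] : complex.Im eps = 0 /\ 0 < complex.Re eps.
  by move: eps0; rewrite ltcE/= => /andP[/eqP].
(* The 2 pays for comparing [norm1 h] with [|h|]; the 1 keeps the denominator positive if
   [K = 0]. *)
have d0 : 0 < Num.min (e / 4) (complex.Re eps / (2 * K + 1)).
  by rewrite lt_min e4/= divr_gt0//; lra.
near=> h.
have h0 : h != 0.
  near: h. apply: filterS (@nbhs_dnbhs_neq (R[i]^o) 0) => w w0. exact: w0.
have hd : norm1 h <= Num.min (e / 4) (complex.Re eps / (2 * K + 1)).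
  near: h; apply: nbhs_dnbhs; have := near_norm1 0 d0.
  by apply: filterS => w; rewrite subr0.
move: hd; rewrite le_min => /andP[he4 heps].
have hm := main h he4.
have -> : D - h^-1 *: (laplace mu (h *: 1 + z) - laplace mu z) =
    - (h^-1 * (laplace mu (h + z) - laplace mu z - h * D)).
  rewrite [h *: 1](_ : _ = h * 1)// mulr1.
  rewrite [h^-1 *: _](_ : _ = h^-1 * (laplace mu (h + z) - laplace mu z))//.
  by field.
rewrite normrN normrM normfV ler_pdivrMl ?normr_gt0//.
apply: le_trans (normr_le_norm1 _) _.
apply: (@le_trans _ _ (K * norm1 h ^+ 2)%:C); first by rewrite lecR.
have -> : eps = (complex.Re eps)%:C by exact: realC_eq.
have hn := norm1_le_normr h.
apply: (@le_trans _ _ ((K * norm1 h)%:C * (2%:R * `|h|))).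
  rewrite expr2 mulrA rmorphM; apply: ler_wpM2l => //.
  by rewrite lecR mulr_ge0// addr_ge0.
rewrite mulrCA mulrA -(rmorph_nat (real_complex R)) -rmorphM mulrC.
apply: ler_wpM2l => //; rewrite lecR.
have : norm1 h * (2 * K + 1) <= complex.Re eps by rewrite -ler_pdivlMr//; lra.
have : 0 <= norm1 h by rewrite addr_ge0.
by move=> n0 hh; nra.
Unshelve. all: by end_near. Qed.

End analytic_measure.

(** * Functionals represented by analytic measures *)

(** The neighbourhood of 0 contains two real points [e] and [- e], and the sum of their exponentials
    dominates [exp (e |x|)]. *)
Lemma expR_of_analytic (R : realType)
    (mu : {finite_measure set (measurableTypeR R) -> \bar R}) :
  analytic_measure mu -> exists2 e : R, 0 < e &
    mu.-integrable setT (fun x => (expR (e * `|x|))%:E).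
Proof.
move=> [/nbhs_ballP[r /= r0 hr] _].
have [r_im r_re] : complex.Im r = 0 /\ 0 < complex.Re r.
  by move: r0; rewrite ltcE/= => /andP[/eqP].
pose e := complex.Re r / 2.
have e0 : 0 < e by rewrite divr_gt0.
have Ie (s : R) : `|s| = e -> mu.-integrable setT (EFin \o (fun x : R => expR (s * x))).
  move=> se; have [|I1 _] := hr s%:C.
    rewrite /ball/= sub0r normrN normc_def/= expr0n/= addr0 sqrtr_sqr se.
    by rewrite (realC_eq r_im) ltcR /e; lra.
  rewrite (_ : EFin \o _ = (fun x : R => (complex.Re (cexp (x%:C * s%:C)))%:E))//.
  by apply: funext => x /=; rewrite !mul0r mulr0 subr0 addr0 cos0 mulr1 mulrC.
exists e => //.
have I1 := Ie e (ger0_norm (ltW e0)).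
have I2 := Ie (- e) (etrans (normrN e) (ger0_norm (ltW e0))).
apply: (integrable_le_norm (measurable_expR_abs e) _ (integrable_addr I1 I2)) => x.
rewrite ger0_norm ?expR_ge0//; apply: le_trans (expR_abs_le _ (ltW e0)) _.
by rewrite -mulNr.
Qed.

Lemma exprn_le_expR (R : realType) (y : R) n : 0 <= y ->
  y ^+ n <= n`!%:R * expR y.
Proof.
move=> y0; case: n => [|n]; first by rewrite expr0 mul1r -expR0 ler_expR.
by have := expR_ge1Dxn n y0; rewrite -ler_pdivrMl ?ltr0n ?fact_gt0// mulrC; lra.
Qed.

(** Each factor [x] is paid with half of the exponent, so [e] varies along the induction. *)
Lemma horner_le_expR (R : realType) (p : {poly R}) (e : R) : 0 < e ->
  exists2 C : R, 0 <= C & forall x, `|p.[x]| <= C * expR (e * `|x|).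
Proof.
elim/poly_ind: p e => [|p c IH] e e0.
  by exists 0 => // x; rewrite horner0 normr0 mul0r.
have e2 : 0 < e / 2 by rewrite divr_gt0.
have [C C0 pC] := IH _ e2.
exists (C / (e / 2) + `|c|); first by rewrite addr_ge0// divr_ge0// ltW.
move=> x; rewrite hornerMXaddC; apply: le_trans (ler_normD _ _) _.
have x0 := normr_ge0 x; rewrite mulrDl normrM; apply: lerD; last first.
  by rewrite ler_peMr// -expR0 ler_expR mulr_ge0// ltW.
have h : `|x| <= (e / 2)^-1 * expR (e / 2 * `|x|).
  by rewrite ler_pdivlMl//; have := expR_ge1Dx (e / 2 * `|x|); lra.
apply: le_trans (ler_pM _ _ (pC x) h) _ => //.
rewrite mulrACA -expRD -mulrDl -splitr.
by rewrite le_eqVlt eqxx.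
Qed.

Lemma integrable_horner (R : realType)
    (mu : {finite_measure set (measurableTypeR R) -> \bar R}) (e : R) (p : {poly R}) :
  0 < e -> mu.-integrable setT (fun x => (expR (e * `|x|))%:E) ->
  mu.-integrable setT (EFin \o horner p).
Proof.
move=> e0 Ie; have [C C0 pC] := horner_le_expR p e0.
apply: (@integrable_le_norm _ (measurableTypeR R) R mu (horner p) _ _ pC).
  exact: measurable_poly.
exact: (integrable_scaler C (f := fun x : measurableTypeR R => expR (e * `|x|)) Ie).
Qed.

Lemma horner_newton (K : comNzRingType) n (x : K) :
  (newton K n).[x] = \prod_(i < n) (x - i%:R).
Proof. by rewrite /newton horner_prod; apply: eq_bigr => i _; rewrite hornerXsubC. Qed.

Lemma newton_le_expR (R : realType) (e x : R) n : 0 < e ->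
  `|(newton R n).[x]| <= (expR e / e) ^+ n * n`!%:R * expR (e * `|x|).
Proof.
move=> e0; rewrite horner_newton normr_prod.
apply: (@le_trans _ _ ((`|x| + n%:R) ^+ n)).
  rewrite -[X in _ ^+ X]card_ord -prodr_const; apply: ler_prod => i _.
  rewrite normr_ge0/=; apply: le_trans (ler_normB _ _) _; rewrite lerD2l.
  by rewrite ger0_norm// ler_nat ltnW.
(* At [y = e (|x| + n)] the bound [y^n <= n! exp y] produces [exp (e n)], the numerator of the base
   [expR e / e]. *)
have y0 : 0 <= e * (`|x| + n%:R) by rewrite mulr_ge0// ?addr_ge0// ltW.
have := exprn_le_expR n y0; rewrite exprMn mulrDr expRD expRM_natr => h.
rewrite expr_div_n -(ler_pM2l (exprn_gt0 n e0)); apply: le_trans h _.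
rewrite le_eqVlt; apply/orP; left; apply/eqP; field.
by rewrite gt_eqF// exprn_gt0.
Qed.

Section represented_functionals.
Variables (R : realType) (mu : {finite_measure set (measurableTypeR R) -> \bar R}).
Variable tau : nat -> R[i].
Hypothesis Ip : forall p, mu.-integrable setT (EFin \o horner p).
Hypothesis mu_tau : represents mu tau.

Lemma pairing_cintegral (f : lfin R) :
  pairing tau f = cintegral mu (fun x => (newton_iso f).[x%:C]).
Proof.
have IN n : cintegrable mu (fun x => ((newton R n).[x])%:C).
  by split => /=; [exact: Ip|exact: (finite_measure_integrable_cst mu 0 measurableT)].
have EN n : cintegral mu (fun x => ((newton R n).[x])%:C) = tau n.
  rewrite /cintegral mu_tau/= (_ : \int[mu]_x 0 = 0)//.
  by rewrite (Rintegral_cst mu measurableT) mul0r.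
have {}EN N : cintegrable mu (fun x => \sum_(n < N) f`_n * ((newton R n).[x])%:C) /\
    cintegral mu (fun x => \sum_(n < N) f`_n * ((newton R n).[x])%:C) =
    \sum_(n < N) tau n * f`_n.
  elim: N => [|N [IH1 IH2]].
    rewrite big_ord0; have [I0 E0] := cintegralZ 0 (IN 0%N).
    rewrite (_ : (fun x => _) = (fun x => 0 * ((newton R 0).[x])%:C)).
      by rewrite E0 mul0r.
    by apply: funext => x; rewrite big_ord0 mul0r.
  have [I1 E1] := cintegralZ f`_N (IN N).
  have [I2 E2] := cintegralD IH1 I1.
  rewrite (_ : (fun x => _) = (fun x => \sum_(n < N) f`_n * ((newton R n).[x])%:C +
      f`_N * ((newton R N).[x])%:C)); last by apply: funext => x; rewrite big_ord_recr.
  by split=> //; rewrite E2 IH2 E1 EN big_ord_recr/= [tau N * _]mulrC.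
rewrite /pairing -(EN _).2; congr cintegral; apply: funext => x.
rewrite /newton_iso horner_sum; apply: eq_bigr => n _.
by rewrite hornerZ -(map_newton (real_complex R)) horner_map.
Qed.

Lemma represents_star_positive : star_positive tau.
Proof.
move=> f; rewrite pairing_cintegral newton_iso_star /cintegral lecE/=.
have E x : ((newton_iso f * map_poly conjc (newton_iso f)).[x%:C] : R[i]) =
    (newton_iso f).[x%:C] * (newton_iso f).[x%:C]^*%C.
  rewrite hornerM; congr (_ * _); rewrite -[in LHS](conjc_real x).
  by rewrite horner_map.
apply/andP; split.
  apply/eqP; rewrite -[RHS](mul0r (fine (mu setT))) -(Rintegral_cst mu measurableT).
  by apply: eq_Rintegral => x _; rewrite E; case: (_.[_]) => u v /=; ring.
apply: Rintegral_ge0 => x _; rewrite E; case: (_.[_]) => u v /=.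
by rewrite mulrN opprK -!expr2 addr_ge0 ?sqr_ge0.
Qed.

Lemma represents_l2_minus (e : R) : 0 < e ->
  mu.-integrable setT (fun x => (expR (e * `|x|))%:E) -> l2_minus tau.
Proof.
move=> e0 Ie; pose C := \int[mu]_x expR (e * `|x|).
pose M := expR e / e.
have M0 : 0 < M by rewrite divr_gt0// expR_gt0.
have C0 : 0 <= C by apply: Rintegral_ge0 => x _; exact: expR_ge0.
have tau_le n : Normc.normc (tau n) <= C * M ^+ n * n`!%:R.
  rewrite mu_tau/= expr0n/= addr0 sqrtr_sqr.
  apply: le_trans (le_normr_Rintegral measurableT (Ip _)) _.
  have IE := integrable_scaler (M ^+ n * n`!%:R)
    (f := fun x : measurableTypeR R => expR (e * `|x|)) Ie.
  apply: le_trans (le_Rintegral measurableT (integrable_norm (Ip _)) IE _) _.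
    by move=> x _; exact: newton_le_expR.
  by rewrite Rintegral_scaler// le_eqVlt; apply/orP; left; apply/eqP; rewrite -/C; ring.
(* Then [2 M^2 <= q <= 2^q], so the terms are at most [C^2 2^-n]. *)
pose q := (Num.bound (2 * M ^+ 2)).
have qM : 2 * M ^+ 2 <= 2 ^+ q.
  apply: (@le_trans _ _ q%:R).
    by apply/ltW/archi_boundP; rewrite mulr_ge0// sqr_ge0.
  by rewrite -natrX ler_nat ltnW// ltn_expl.
exists q.
have term n : Normc.normc (tau n) ^+ 2 * n`!%:R ^- 2 * 2 ^- (q * n) <= C ^+ 2 * 2^-1 ^+ n.
  have f0 : 0 < n`!%:R :> R by rewrite ltr0n fact_gt0.
  have P0 : 0 < 2 ^+ q :> R by rewrite exprn_gt0.
  rewrite exprM -mulrA -invfM ler_pdivrMr ?mulr_gt0 ?exprn_gt0//.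
  apply: (@le_trans _ _ ((C * M ^+ n * n`!%:R) ^+ 2)).
    rewrite lerXn2r// nnegrE; last by rewrite !mulr_ge0 ?exprn_ge0 ?(ltW M0).
    by case: (tau n) => a b; exact: sqrtr_ge0.
  rewrite (_ : (C * _ * _) ^+ 2 = C ^+ 2 * n`!%:R ^+ 2 * (M ^+ 2) ^+ n); last first.
    by rewrite -[(M ^+ 2) ^+ n]exprM mulnC exprM !exprMn; ring.
  rewrite [leRHS](_ : _ = C ^+ 2 * n`!%:R ^+ 2 * (2^-1 * 2 ^+ q) ^+ n); last first.
    by rewrite exprMn; ring.
  apply: ler_wpM2l; first by rewrite mulr_ge0 ?sqr_ge0.
  by rewrite lerXn2r ?nnegrE ?sqr_ge0 ?mulr_ge0 ?(ltW P0)// ler_pdivlMl.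
apply: le_lt_trans (ltry (2 * C ^+ 2)).
have u0 n : (0 <= (Normc.normc (tau n) ^+ 2 * n`!%:R ^- 2 * 2 ^- (q * n))%:E)%E.
  rewrite lee_fin; apply: mulr_ge0; last by rewrite invr_ge0 exprn_ge0.
  by apply: mulr_ge0; [exact: sqr_ge0|rewrite invr_ge0 exprn_ge0].
apply: lime_le; first by apply: is_cvg_nneseries => n _ _; exact: u0.
apply: nearW => N; rewrite sumEFin lee_fin.
apply: (@le_trans _ _ (\sum_(0 <= k < N) C ^+ 2 * 2^-1 ^+ k)).
  by apply: ler_sum => k _; exact: term.
rewrite -mulr_sumr mulrC; apply: ler_wpM2r; first exact: sqr_ge0.
rewrite big_mkord.
have -> : \sum_(k < N) (2^-1 : R) ^+ k = 2 - 2 * 2^-1 ^+ N.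
  elim: N => [|N IH]; first by rewrite big_ord0 expr0; lra.
  by rewrite big_ord_recr/= IH exprS; field.
have : 0 <= (2^-1 : R) ^+ N by rewrite exprn_ge0// invr_ge0.
by lra.
Qed.

End represented_functionals.

(** * Determinacy *)

(* The cubic maps [-1, 1] to itself with attracting fixed points -1 and 1, so
   its iterates are polynomials converging boundedly to the sign. *)
Definition sign_iter (R : realType) (v : R) (n : nat) : R :=
  iter n (fun u => (3 * u - u ^+ 3) / 2) v.

Section sign_iter.
Variable R : realType.
Implicit Types v : R.

Lemma sign_iterN v n : sign_iter (- v) n = - sign_iter v n.
Proof.
elim: n => //= n IH; rewrite /sign_iter/= -!/(sign_iter _ n) IH.
by rewrite [(- _) ^+ 3]exprS sqrrN; field.
Qed.

(** One step multiplies [1 - u] by [1 - u (1 + u) / 2], which is at most [1 - v / 2] as the iterates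
    stay above [v]. *)
Lemma sign_iter_pos v n : 0 < v <= 1 ->
  v <= sign_iter v n <= 1 /\ 1 - sign_iter v n <= (1 - v / 2) ^+ n.
Proof.
move=> /andP[v0 v1]; elim: n => [|n [/andP[IH1 IH2] IH3]].
  by rewrite /sign_iter/= lexx v1 expr0; split => //; lra.
rewrite /sign_iter/= -!/(sign_iter _ n); set u := sign_iter v n in IH1 IH2 IH3 *.
have E : 1 - (3 * u - u ^+ 3) / 2 = (1 - u) * (1 - u * (1 + u) / 2) by field.
have E2 : (3 * u - u ^+ 3) / 2 - u = u * ((1 - u) * (1 + u)) / 2 by field.
have h1 : 0 <= u * ((1 - u) * (1 + u)) / 2.
  by rewrite divr_ge0// mulr_ge0 ?mulr_ge0//; lra.
have h2 : 0 <= 1 - u * (1 + u) / 2 <= 1 - v / 2 by apply/andP; split; nra.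
have h3 : 0 <= (1 - u) * (1 - u * (1 + u) / 2).
  by apply: mulr_ge0; [lra|case/andP: h2].
split; first by apply/andP; split; lra.
rewrite E exprSr; apply: ler_pM => //; [lra|by case/andP: h2..].
Qed.

Lemma sign_iter_norm v n : `|v| <= 1 -> `|sign_iter v n| <= 1.
Proof.
have sgn0 : sign_iter (0 : R) n = 0.
  by elim: n => //= n IH; rewrite /sign_iter/= -/(sign_iter _ n) IH; field.
have pos (w : R) : 0 <= w <= 1 -> `|sign_iter w n| <= 1.
  have [->|w0] := eqVneq w 0; first by rewrite sgn0 normr0.
  move=> /andP[w1 w2]; have [|/andP[h1 h2] _] := @sign_iter_pos w n.
    by rewrite lt_def w0 w1.
  by rewrite ger0_norm//; lra.
have [v0|v0] := ger0P v => v1; first by apply: pos; rewrite v0.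
rewrite -[v]opprK sign_iterN normrN; apply: pos.
by rewrite v1 oppr_ge0 ltW.
Qed.

Lemma cvg_sign_iter v : `|v| <= 1 -> sign_iter v n @[n --> \oo] --> Num.sg v.
Proof.
have pos (w : R) : 0 < w <= 1 -> sign_iter w n @[n --> \oo] --> (1 : R).
  move=> w01; have /andP[w0 w1] := w01.
  have q1 : `|1 - w / 2| < 1 by rewrite ger0_norm; lra.
  have /cvgrPdist_le hq := cvg_expr q1.
  apply/cvgrPdist_le => e e0; near=> n.
  have [/andP[h1 h2] h3] := sign_iter_pos n w01.
  rewrite ger0_norm ?subr_ge0//; apply: le_trans h3 _.
  have : `|0 - (1 - w / 2) ^+ n| <= e by near: n; exact: hq.
  by rewrite sub0r normrN ger0_norm// exprn_ge0//; lra.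
have [v0|v0|->] := ltrgt0P v => v1.
- by rewrite gtr0_sg//; apply: pos; rewrite v0.
- rewrite ltr0_sg// (_ : sign_iter v = fun n => - sign_iter (- v) n).
    by apply: cvgN; apply: pos; rewrite oppr_gt0 v0.
  by apply: funext => n; rewrite sign_iterN opprK.
- rewrite sgr0 (_ : sign_iter 0 = fun=> 0); first exact: cvg_cst.
  apply: funext; elim=> //= n IH.
  by rewrite /sign_iter/= -/(sign_iter _ n) IH; field.
Unshelve. all: by end_near. Qed.

End sign_iter.

Lemma sin_series_le (R : realType) (y : R) N :
  `|\sum_(k < N) sin_coeff y k| <= expR `|y|.
Proof.
apply: le_trans (ler_norm_sum _ _ _) _.
apply: (@le_trans _ _ (\sum_(k < N) `|y| ^+ k / k`!%:R)).
  apply: ler_sum => k _; rewrite /sin_coeff/= !normrM normfV !normr_nat !normrX.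
  rewrite normrN normr1 expr1n mulr1.
  by case: odd; rewrite ?mul1r// mul0r mul0r divr_ge0// exprn_ge0.
rewrite -(cvg_lim (@Rhausdorff R) (@cvg_expR_series R `|y|)).
apply: (@nondecreasing_cvgn_le _ (fun N => \sum_(k < N) `|y| ^+ k / k`!%:R)).
  apply/nondecreasing_seqP => n; rewrite big_ord_recr/= lerDl.
  by rewrite divr_ge0// exprn_ge0.
by apply/cvg_ex; eexists; exact: cvg_expR_series.
Qed.

Section determinacy.
Variables (R : realType).
Variables (mu nu : {finite_measure set (measurableTypeR R) -> \bar R}) (e : R).
Hypothesis e0 : 0 < e.
Hypothesis Imu : mu.-integrable setT (fun x => (expR (e * `|x|))%:E).
Hypothesis Inu : nu.-integrable setT (fun x => (expR (e * `|x|))%:E).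
Hypothesis same_moments : forall p : {poly R},
  \int[mu]_x p.[x] = \int[nu]_x p.[x].

(** Testing against all polynomials lets the partial sums of a power series be moved from [g] onto
    [p]; boundedness of [g] keeps [p * g] integrable. *)
Definition same_integrals (g : R -> R) :=
  [/\ measurable_fun (setT : set (measurableTypeR R)) g,
      exists B, forall x, `|g x| <= B &
      forall p : {poly R}, \int[mu]_x (p.[x] * g x) = \int[nu]_x (p.[x] * g x)].

Let integrable_pg (la : {finite_measure set (measurableTypeR R) -> \bar R})
    (p : {poly R}) (g : R -> R) (B : R) :
  la.-integrable setT (fun x => (expR (e * `|x|))%:E) ->
  measurable_fun (setT : set (measurableTypeR R)) g -> (forall x, `|g x| <= B) ->
  la.-integrable setT (EFin \o (fun x => p.[x] * g x)).
Proof.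
move=> Ila mg gB; have Ip := integrable_horner p e0 Ila.
have IBp := integrable_scaler B (integrable_norm Ip).
apply: (integrable_le_norm _ _ IBp).
  by apply: measurable_funM => //; exact: measurable_poly.
move=> x; rewrite [leRHS](_ : _ = B * `|p.[x]|)// normrM mulrC.
exact: ler_wpM2r.
Qed.

Lemma same_integrals_cst c : same_integrals (cst c).
Proof.
split => //; first by exists `|c|.
move=> p; have := same_moments (p * c%:P).
rewrite (_ : horner (p * c%:P) = (fun x => p.[x] * cst c x))//.
by apply: funext => x; rewrite hornerM hornerC.
Qed.

Lemma same_integralsD f g : same_integrals f -> same_integrals g ->
  same_integrals (f + g).
Proof.
move=> [mf [Bf fB] Ef] [mg [Bg gB] Eg]; split.
- exact: measurable_funD.
- exists (Bf + Bg) => x; apply: le_trans (ler_normD _ _) _; exact: lerD.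
- move=> p; have If la Ila := @integrable_pg la p f Bf Ila mf fB.
  have Ig la Ila := @integrable_pg la p g Bg Ila mg gB.
  have E : (fun x => p.[x] * (f + g) x) = (fun x => p.[x] * f x) + (fun x => p.[x] * g x).
    by apply: funext => x; exact: mulrDr.
  by rewrite E !Rintegral_addr ?Ef ?Eg//; [exact: If|exact: Ig|exact: If|exact: Ig].
Qed.

Lemma same_integrals_lim (f_ : nat -> R -> R) f B :
  (forall n, same_integrals (f_ n)) -> (forall n x, `|f_ n x| <= B) ->
  (forall x, f_ n x @[n --> \oo] --> f x) -> same_integrals f.
Proof.
move=> Kf fB cf.
have mf n : measurable_fun (setT : set (measurableTypeR R)) (f_ n) by have [] := Kf n.
split.
- by apply: (measurable_fun_cvg mf) => x _; exact: cf.
- exists B => x; rewrite -(cvg_lim (@Rhausdorff R) (cvg_norm (cf x))).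
  apply: limr_le; first by apply/cvg_ex; exists `|f x|; exact: (cvg_norm (cf x)).
  exact: nearW.
move=> p; have lim_ (la : {finite_measure set (measurableTypeR R) -> \bar R}) :
    la.-integrable setT (fun x => (expR (e * `|x|))%:E) ->
    \int[la]_x (p.[x] * f_ n x) @[n --> \oo] --> \int[la]_x (p.[x] * f x).
  move=> Ila; have Ip := integrable_horner p e0 Ila.
  have IBp := integrable_scaler B (integrable_norm Ip).
  have [||||//] := @Rintegral_dominated_cvg _ _ _ la (fun n x => p.[x] * f_ n x)
    (fun x => p.[x] * f x) (B *: (Num.norm \o horner p)).
  - move=> n; apply: measurable_funM; [exact: measurable_poly|exact: mf].
  - by move=> x; apply: cvgMr; exact: cf.
  - move=> n x; rewrite [leRHS](_ : _ = B * `|p.[x]|)// normrM mulrC.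
    exact: ler_wpM2r.
  - exact: IBp.
apply: (cvg_unique _ (lim_ mu Imu)) => //.
rewrite (_ : (fun n => _) = (fun n => \int[nu]_x (p.[x] * f_ n x))); first exact: lim_.
by apply: funext => n; have [_ _] := Kf n.
Qed.

(* The partial sums of the sine series are polynomials in [x] bounded by
   [expR (e / 2 * `|x|)], which is where exponential integrability enters. *)
Lemma same_integrals_sin t g : `|t| <= e / 2 -> same_integrals g ->
  same_integrals (fun x => g x * sin (t * x)).
Proof.
move=> te [mg [B gB] Eg].
have B0 : 0 <= B := le_trans (normr_ge0 _) (gB 0).
have e2 : 0 < e / 2 by rewrite divr_gt0.
pose P N : {poly R} := \poly_(k < N) sin_coeff t k.
have PE N x : (P N).[x] = \sum_(k < N) sin_coeff (t * x) k.
  rewrite horner_poly; apply: eq_bigr => k _.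
  by rewrite /sin_coeff/= exprMn; ring.
have P_le N x : `|(P N).[x]| <= expR (e / 2 * `|x|).
  rewrite PE; apply: le_trans (sin_series_le _ _) _.
  by rewrite ler_expR normrM; exact: ler_wpM2r.
have P_cvg x : (P N).[x] @[N --> \oo] --> sin (t * x).
  rewrite (_ : (fun N => _) = series (sin_coeff (t * x))).
    by rewrite unlock; exact: is_cvg_series_sin_coeff.
  by apply: funext => N; rewrite seriesEord PE.
split.
- apply: measurable_funM => //.
  apply: (@measurableT_comp _ _ _ _ _ _ (@sin R)); last exact: measurable_funM.
  by apply: continuous_measurable_fun; exact: continuous_sin.
- exists B => x; rewrite normrM -[leRHS]mulr1; apply: ler_pM => //.
  exact: sin_max.
(* The sine series uses at most [e / 2]; the other half dominates [p]. *)
move=> p; have [C C0 pC] := horner_le_expR p e2.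
have lim_ (la : {finite_measure set (measurableTypeR R) -> \bar R}) :
    la.-integrable setT (fun x => (expR (e * `|x|))%:E) ->
    \int[la]_x ((p * P N).[x] * g x) @[N --> \oo] --> \int[la]_x (p.[x] * (g x * sin (t * x))).
  move=> Ila.
  have IE := integrable_scaler (B * C)
    (f := fun x : measurableTypeR R => expR (e * `|x|)) Ila.
  have [|||//] := @Rintegral_dominated_cvg _ _ _ la (fun N x => (p * P N).[x] * g x)
    (fun x => p.[x] * (g x * sin (t * x))) _ _ _ _ IE.
  - by move=> n; apply: measurable_funM; [exact: measurable_poly|exact: mg].
  - move=> x; rewrite (_ : (fun N => _) = (fun N => p.[x] * (g x * (P N).[x]))).
      by apply: cvgMr; apply: cvgMr; exact: P_cvg.
    by apply: funext => N; rewrite hornerM; ring.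
  - move=> N x; rewrite [leRHS](_ : _ = B * C * expR (e * `|x|))//.
    rewrite normrM mulrC hornerM normrM -mulrA; apply: ler_pM => //.
    rewrite [e in leRHS]splitr mulrDl expRD mulrA.
    exact: ler_pM.
apply: (cvg_unique _ (lim_ mu Imu)) => //.
rewrite (_ : (fun N => _) = (fun N => \int[nu]_x ((p * P N).[x] * g x))); first exact: lim_.
by apply: funext => N; exact: Eg.
Qed.

Lemma same_integrals_horner_sin t (h : {poly R}) : `|t| <= e / 2 ->
  same_integrals (fun x => h.[sin (t * x)]).
Proof.
move=> te; elim/poly_ind: h => [|h c IH].
  rewrite (_ : (fun x => _) = cst 0); first exact: same_integrals_cst.
  by apply: funext => x; rewrite horner0.
rewrite (_ : (fun x => _) = (fun x => h.[sin (t * x)] * sin (t * x)) + cst c).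
  by apply: same_integralsD; [exact: same_integrals_sin|exact: same_integrals_cst].
by apply: funext => x; rewrite hornerMXaddC.
Qed.

Lemma same_integrals_gt_sin t c : `|t| <= e / 2 -> `|c| <= 1 ->
  same_integrals (fun x => (c < sin (t * x))%R%:R).
Proof.
move=> te c1; pose v x := 2^-1 * (sin (t * x) - c).
have v1 x : `|v x| <= 1.
  rewrite normrM ger0_norm ?invr_ge0// ler_pdivrMl// mulr1.
  by apply: le_trans (ler_normB _ _) _; have := sin_max (t * x); lra.
pose H := fix H n : {poly R} := if n is n'.+1 then
  2^-1 *: (3 *: H n' - H n' ^+ 3) else 2^-1 *: ('X - c%:P).
have HE n x : (H n).[sin (t * x)] = sign_iter (v x) n.
  elim: n => [|n IH] /=; first by rewrite hornerZ hornerXsubC.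
  rewrite hornerZ hornerD hornerN hornerZ horner_exp IH.
  by rewrite /sign_iter/= -!/(sign_iter _ n) mulrC.
(* [(s + s^2) / 2] is 1, 0, 0 at [s] = 1, 0, -1, which gives the strict inequality exactly. *)
pose w n x := 2^-1 * (sign_iter (v x) n + sign_iter (v x) n ^+ 2).
apply: (@same_integrals_lim w _ 1) => [n|n x|x].
- rewrite (_ : w n = (fun x => (2^-1 *: (H n + H n ^+ 2)).[sin (t * x)])).
    exact: same_integrals_horner_sin.
  by apply: funext => x; rewrite hornerZ hornerD horner_exp HE.
- have := sign_iter_norm n (v1 x); rewrite /w !ler_norml => /andP[h1 h2].
  by apply/andP; split; nra.
have -> : (c < sin (t * x))%R%:R = 2^-1 * (Num.sg (v x) + Num.sg (v x) ^+ 2) :> R.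
  have -> : (c < sin (t * x)) = (0 < v x) by rewrite /v pmulr_rgt0 ?invr_gt0// subr_gt0.
  have [v0|v0|->] := ltrgt0P (v x).
  - by rewrite gtr0_sg//= mulr1n; field.
  - by rewrite ltr0_sg//= mulr0n; field.
  - by rewrite sgr0 /= mulr0n; field.
apply: cvgMr; apply: cvgD; first exact/cvg_sign_iter.
by apply: cvgM; exact/cvg_sign_iter.
Qed.

(* As [t] tends to 0, [sin] is increasing on an ever larger interval around
   [t * a], so [sin (t * a) < sin (t * x)] ends up meaning [a < x]. *)
Lemma same_integrals_gt a : same_integrals (fun x => (a < x)%R%:R).
Proof.
pose t n := (e / 2) / n.+1%:R.
have t0 n : 0 < t n by rewrite divr_gt0// divr_gt0.
apply: (@same_integrals_lim (fun n x => (sin (t n * a) < sin (t n * x))%R%:R) _ 1).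
- move=> n; apply: same_integrals_gt_sin; last exact: sin_max.
  rewrite gtr0_norm// ler_pdivrMr// ler_peMr ?ler1n// ltW// divr_gt0//.
- by move=> n x; case: (_ < _); rewrite ?normr1 ?normr0.
move=> x; apply: cvg_near_cst; near=> n; congr (_%:R).
(* Eventually [|t n * y| <= 1 <= pi / 2], inside the interval where [sin] increases. *)
have small y : `|y| <= `|x| + `|a| -> t n * y \in `[- (pi / 2), pi / 2].
  move=> ya; have h : `|t n * y| <= pi / 2.
    apply: (@le_trans _ _ 1); last by rewrite ler_pdivlMr// mul1r pi_ge2.
    rewrite normrM gtr0_norm// /t mulrAC ler_pdivrMr// mul1r.
    apply: (@le_trans _ _ (e / 2 * (`|x| + `|a|))).
      by apply: ler_wpM2l => //; rewrite divr_ge0// ltW.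
    apply: (@le_trans _ _ n%:R); last by rewrite ler_nat.
    by near: n; exact: nbhs_infty_ger.
  by rewrite in_itv/= -ler_norml.
by rewrite ltr_sin ?ltr_pM2l//; apply: small; rewrite ?lerDl ?lerDr.
Unshelve. all: by end_near. Qed.

(** Testing with [p = 1] gives equal finite masses on rays, hence on the intervals []a, b]], a
    generating class stable under intersection. *)
Lemma same_moments_unique (A : set (measurableTypeR R)) :
  measurable A -> mu A = nu A.
Proof.
have ray a : mu `]a, +oo[%classic = nu `]a, +oo[%classic.
  have [_ _ /(_ 1%:P) h] := same_integrals_gt a.
  have E (la : {finite_measure set (measurableTypeR R) -> \bar R}) :
      \int[la]_x ((1%:P : {poly R}).[x] * (a < x)%R%:R) = fine (la `]a, +oo[%classic).
    rewrite -[X in la X]setIT -(integral_indic la measurableT); last exact: measurable_itv.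
    rewrite /Rintegral; congr fine; apply: eq_integral => x _.
    by rewrite hornerC mul1r indicE mem_setE in_itv/= andbT.
  rewrite !E in h; rewrite -[LHS]fineK; last exact: fin_num_measure.
  by rewrite h fineK//; exact: fin_num_measure.
have itv a b : mu `]a, b]%classic = nu `]a, b]%classic.
  have [ab|ba] := leP a b; last first.
    by rewrite set_itv_ge ?measure0// -leNgt bnd_simp ltW.
  have E (la : {finite_measure set (measurableTypeR R) -> \bar R}) :
      la `]a, b]%classic = (la `]a, +oo[%classic - la `]b, +oo[%classic)%E.
    have mI (c : R) : measurable (`]c, +oo[%classic : set (measurableTypeR R)).
      exact: measurable_itv.
    have -> : `]a, +oo[%classic = (`]a, b] `|` `]b, +oo[)%classic :> set R.
      by rewrite -itv_bndbnd_setU.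
    rewrite measureU//; last first.
      apply/seteqP; split => // x /= []; rewrite !in_itv/= andbT => /andP[_ xb] bx.
      by move: (lt_le_trans bx xb); rewrite ltxx.
    by rewrite addeK// fin_num_measure.
  by rewrite !E !ray.
move=> mA; apply: (@measure_unique _ R (measurableTypeR R) (@ocitv R)
  (fun k => `](- k%:R), k%:R]%classic) _ _ _ _ mu nu) => //.
- exact: ocitvI.
- by move=> k; exact: is_ocitv.
- rewrite -subTset => x _; exists (Num.bound `|x|) => //=.
  have := archi_boundP (normr_ge0 x); rewrite in_itv/=.
  have := ler_norm x; have := ler_norm (- x); rewrite normrN => h1 h2 h3.
  by apply/andP; split; [lra|exact: le_trans h2 (ltW h3)].
- by move=> _ [[a b] _ <-]; exact: itv.
- by move=> k; rewrite -ge0_fin_numE// fin_num_measure//; exact: sub_sigma_algebra (is_ocitv _ _).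
Qed.

End determinacy.

(** [represents] fixes the integrals of Newton polynomials, while determinacy asks for all
    polynomials. The recursion for [x (x)_k] passes to monomials. *)
Lemma linear_eq_newton (R : realType) (L1 L2 : {poly R} -> R) :
  (forall a p q, L1 (a *: p + q) = a * L1 p + L1 q) ->
  (forall a p q, L2 (a *: p + q) = a * L2 p + L2 q) ->
  (forall n, L1 (newton R n) = L2 (newton R n)) -> forall p, L1 p = L2 p.
Proof.
move=> lin1 lin2 LN.
have LXN n k : L1 ('X^n * newton R k) = L2 ('X^n * newton R k).
  elim: n k => [|n IH] k; first by rewrite mul1r.
  have -> : 'X^(n.+1) * newton R k =
      k%:R *: ('X^n * newton R k) + 'X^n * newton R k.+1 :> {poly R}.
    by rewrite exprSr -mulrA mulX_newton -!mul_polyC; ring.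
  by rewrite lin1 lin2 !IH.
have LX n : L1 'X^n = L2 'X^n by have := LXN n 0%N; rewrite newton0 mulr1.
suff LpX p n : L1 (p * 'X^n) = L2 (p * 'X^n) by move=> p; have := LpX p 0%N; rewrite mulr1.
elim/poly_ind: p n => [|p c IH] n.
  have L0 L : (forall a p q, L (a *: p + q) = a * L p + L q) -> L (0 : {poly R}) = 0 :> R.
    by move=> /(_ (-1) 0 0); rewrite scaler0 addr0; lra.
  by rewrite mul0r !L0.
have -> : (p * 'X + c%:P) * 'X^n = c *: 'X^n + p * 'X^(n.+1) by rewrite exprS -mul_polyC; ring.
by rewrite lin1 lin2 LX IH.
Qed.

Lemma Rintegral_horner_linear (R : realType)
    (mu : {finite_measure set (measurableTypeR R) -> \bar R}) :
  (forall p, mu.-integrable setT (EFin \o horner p)) ->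
  forall (a : R) (p q : {poly R}),
  \int[mu]_x (a *: p + q).[x] = a * \int[mu]_x p.[x] + \int[mu]_x q.[x].
Proof.
move=> Ip a p q; rewrite -Rintegral_scaler; last exact: Ip.
rewrite -Rintegral_addr; [|exact: integrable_scaler a _ (Ip p)|exact: Ip].
by apply: eq_Rintegral => x _; rewrite hornerD hornerZ.
Qed.

Theorem theorem6p9 (R : realType) (tau : nat -> R[i]) :
  (analytic_moment_functional tau <-> star_positive tau /\ l2_minus tau) /\
  (forall mu nu : {finite_measure set (measurableTypeR R) -> \bar R},
     analytic_measure mu -> represents mu tau ->
     analytic_measure nu -> represents nu tau ->
     forall A : set (measurableTypeR R), measurable A -> mu A = nu A).
Proof.
split; [split|].
- move=> [mu [amu mu_tau]]; have [e e0 Ie] := expR_of_analytic amu.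
  have Ip p := integrable_horner p e0 Ie.
  split; first exact: (represents_star_positive Ip mu_tau).
  exact: (represents_l2_minus Ip mu_tau e0 Ie).
- move=> [tau_ge0 tau_l2].
  have [L [Llin Lpos tauE]] := star_positive_functional tau_ge0.
  have [C [M [C0 M1 tau_le]]] := l2_minus_bound tau_l2.
  have LN n : `|L (newton R n)| <= C * M ^+ n * n`!%:R.
    by have := tau_le n; rewrite tauE/= expr0n/= addr0 sqrtr_sqr.
  have [mu muL] := hamburger Llin Lpos.
  have Ip p := (muL p).1.
  have mom n : `|\int[mu]_x x ^+ n| <= C * (2 * M) ^+ n * n`!%:R.
    have := moment_growth Llin C0 M1 LN n 0.
    rewrite newton0 mulr1 expr0 mulr1 addn0 -(muL 'X^n).2.
    rewrite (@eq_Rintegral _ _ _ mu setT (fun x => x ^+ n))//.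
    by move=> x _; rewrite hornerXn.
  have M2 : 0 < 2 * M by lra.
  have [e e0 Ie] := integrable_expR_of_moments C0 M2 Ip mom.
  exists mu; split; first exact: (analytic_measure_of_expR e0 Ie).
  by move=> n; rewrite tauE (muL _).2.
- move=> mu nu amu mu_tau anu nu_tau A mA.
  have [e1 e1_0 Ie1] := expR_of_analytic amu.
  have [e2 e2_0 Ie2] := expR_of_analytic anu.
  have Ip1 p := integrable_horner p e1_0 Ie1.
  have Ip2 p := integrable_horner p e2_0 Ie2.
  (* Determinacy needs one exponent for both measures. *)
  pose e := Num.min e1 e2.
  have e0 : 0 < e by rewrite lt_min e1_0.
  have Ie (la : {finite_measure set (measurableTypeR R) -> \bar R}) (e' : R) :
      e <= e' -> la.-integrable setT (fun x => (expR (e' * `|x|))%:E) ->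
      la.-integrable setT (fun x => (expR (e * `|x|))%:E).
    move=> ee' I'; apply: (integrable_le_norm (measurable_expR_abs e) _ I') => x.
    by rewrite ger0_norm ?expR_ge0// ler_expR; exact: ler_wpM2r.
  apply: (same_moments_unique e0 (Ie mu e1 _ Ie1) (Ie nu e2 _ Ie2)) => //.
  + by rewrite ge_min lexx.
  + by rewrite ge_min lexx orbT.
  + apply: linear_eq_newton; [exact: Rintegral_horner_linear..|].
    by move=> n; have := nu_tau n; rewrite mu_tau => -[].
Qed.
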